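(* Let $\mathcal{A}$ be a unital $C^*$-algebra, $n,k\ge1$, $m=\lfloor (k+1)/2\rfloor$, and let $\varphi=[\varphi_{ij}]$ and $\psi=[\psi_{ij}]$ be invariant completely positive block $k$-linear maps from $M_n(\mathcal{A})^k$ to $M_n(\mathbb{C})$. Let $\left(\{\pi_i^{(\varphi)}\}_{i=1}^m,\{V_i^{(\varphi)}\}_{i=1}^n,\mathcal{K}^{(\varphi)}\right)$ be a minimal Stinespring triple of $\varphi$. Then $\psi\le\varphi$ if and only if there exists $T\in\bigcap_{i=1}^m\pi_i^{(\varphi)}(\mathcal{A})'$ with $0\le T\le I$ such that, for all $1\le i,j\le n$: (i) if $k=2m-1$, then $$\psi_{ij}(a_1,\ldots,a_{2m-1})=V_i^{(\varphi)*}T\pi_1^{(\varphi)}(a_m)\pi_2^{(\varphi)}(a_{m-1}a_{m+1})\cdots\pi_m^{(\varphi)}(a_1a_{2m-1})V_j^{(\varphi)}$$ for all $a_1,\ldots,a_{2m-1}\in\mathcal{A}$; (ii) if $k=2m$, then $$\psi_{ij}(a_1,\ldots,a_{2m})=V_i^{(\varphi)*}T\pi_1^{(\varphi)}(a_ma_{m+1})\pi_2^{(\varphi)}(a_{m-1}a_{m+2})\cdots\pi_m^{(\varphi)}(a_1a_{2m})V_j^{(\varphi)}$$ for all $a_1,\ldots,a_{2m}\in\mathcal{A}$.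
   Context: Below, $\mathcal{H}=\mathbb{C}$, so that $\mathcal{B}(\mathcal{H})=\mathbb{C}$. Block maps: given $k$-linear maps $\varphi_{ij}:\mathcal{A}^k\to\mathbb{C}$, $1\le i,j\le n$, the block $k$-linear map $\varphi=[\varphi_{ij}]:M_n(\mathcal{A})^k\to M_n(\mathbb{C})$ sends $(A_1,\ldots,A_k)$, $A_l=[a_{l,ij}]$, to the matrix with $(i,j)$ entry $\sum_{r_1,\ldots,r_{k-1}=1}^n\varphi_{ij}(a_{1,ir_1},a_{2,r_1r_2},\ldots,a_{k,r_{k-1}j})$. Positivity: a $k$-linear map $\Phi$ from $\mathcal{C}^k$ to $\mathcal{D}$ ($\mathcal{C},\mathcal{D}$ unital $C^*$-algebras) is positive if $\Phi(x_1,\ldots,x_k)\ge0$ whenever $(x_1,\ldots,x_k)=(x_k^*,\ldots,x_1^* )$, with the additional assumption $x_m\ge0$ when $k=2m-1$ is odd. Complete positivity: for $t\in\mathbb{N}$ the $t$-amplification $\varphi_t:M_t(M_n(\mathcal{A}))^k\to M_t(M_n(\mathbb{C}))$ sends $([A_{1,ij}],\ldots,[A_{k,ij}])$, with $A_{l,ij}\in M_n(\mathcal{A})$, to the $t\times t$ block matrix with $(i,j)$ entry $\sum_{r_1,\ldots,r_{k-1}=1}^t\varphi(A_{1,ir_1},A_{2,r_1r_2},\ldots,A_{k,r_{k-1}j})$. The block map $\varphi$ is completely positive if $\varphi_t$ is positive for all $t\in\mathbb{N}$. Invariance: $\varphi$ is invariant if, when $k=2m-1$, $\varphi(A_1C_1,\ldots,A_{m-1}C_{m-1},A_m,A_{m+1},\ldots,A_{2m-1})=\varphi(A_1,\ldots,A_{m-1},A_m,C_{m-1}A_{m+1},\ldots,C_1A_{2m-1})$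 for all $A_l,C_l\in M_n(\mathcal{A})$; and, when $k=2m$, $\varphi(A_1C_1,\ldots,A_mC_m,A_{m+1},\ldots,A_{2m})=\varphi(A_1,\ldots,A_m,C_mA_{m+1},\ldots,C_1A_{2m})$ for all $A_l,C_l\in M_n(\mathcal{A})$. Order: $\psi\le\varphi$ means that $\varphi-\psi$ is an invariant completely positive block $k$-linear map. Stinespring triple: a triple $(\{\pi_i\}_{i=1}^m,\{V_i\}_{i=1}^n,\mathcal{K})$ consisting of a Hilbert space $\mathcal{K}$, unital $*$-homomorphisms $\pi_1,\ldots,\pi_m:\mathcal{A}\to\mathcal{B}(\mathcal{K})$ with mutually commuting ranges, and $V_i\in\mathcal{B}(\mathcal{H},\mathcal{K})$, is a Stinespring triple of $\varphi$ if for all $1\le i,j\le n$ and all $a_l\in\mathcal{A}$: $\varphi_{ij}(a_1,\ldots,a_{2m-1})=V_i^*\pi_1(a_m)\pi_2(a_{m-1}a_{m+1})\cdots\pi_m(a_1a_{2m-1})V_j$ when $k=2m-1$, and $\varphi_{ij}(a_1,\ldots,a_{2m})=V_i^*\pi_1(a_ma_{m+1})\pi_2(a_{m-1}a_{m+2})\cdots\pi_m(a_1a_{2m})V_j$ when $k=2m$. It is minimal if $\mathcal{K}=\overline{\mathrm{span}}\left\{\pi_1(\mathcal{A})\cdots\pi_m(\mathcal{A})\left(\sum_{i=1}^nV_i\mathcal{H}\right)\right\}$. Commutant: $\bigcap_{i=1}^m\pi_i^{(\varphi)}(\mathcal{A})'=\{T\in\mathcal{B}(\mathcal{K}^{(\varphi)}):\pi_i^{(\varphi)}(a)T=T\pi_i^{(\varphi)}(a)\text{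 for all }a\in\mathcal{A},\ 1\le i\le m\}$. *)

(* Defs.v *)
From HB Require Import structures.
From mathcomp Require Import all_boot all_order all_algebra sesquilinear.
From mathcomp Require Import complex.
From mathcomp Require Import all_classical all_reals all_analysis.
Set Implicit Arguments.
Unset Strict Implicit.
Unset Printing Implicit Defensive.
Import Order.TTheory GRing.Theory Num.Theory.
Import numFieldNormedType.Exports.
Local Open Scope ring_scope.
Local Open Scope classical_set_scope.

HB.mixin Record isStarRing A & GRing.PzRing A := {
  star : A -> A;
  starK : involutive star;
  starD : {morph star : x y / x + y};
  starM : forall x y : A, star (x * y) = star y * star x
}.

#[short(type="starRingType")]
HB.structure Definition StarRing := {A of isStarRing A & GRing.PzRing A}.

Section ComplexStar.
Variable R : realType.

Definition cstar (z : R[i]) : R[i] := z^*.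

Lemma cstarK : involutive cstar.
Proof. exact: conjCK. Qed.

Lemma cstarD : {morph cstar : x y / x + y}.
Proof. exact: rmorphD. Qed.

Lemma cstarM x y : cstar (x * y) = cstar y * cstar x.
Proof. by rewrite /cstar rmorphM mulrC. Qed.

HB.instance Definition _ := isStarRing.Build R[i] cstarK cstarD cstarM.

End ComplexStar.

Section MatrixStar.
Variables (A : starRingType) (n : nat).

Definition mxstar (X : 'M[A]_n) : 'M[A]_n := \matrix_(i, j) star (X j i).

Lemma star0 : star (0 : A) = 0.
Proof. by apply: (@addrI _ (star 0)); rewrite -starD !addr0. Qed.

Lemma mxstarK : involutive mxstar.
Proof. by move=> X; apply/matrixP => i j; rewrite !mxE starK. Qed.

Lemma mxstarD : {morph mxstar : X Y / X + Y}.
Proof. by move=> X Y; apply/matrixP => i j; rewrite !mxE starD. Qed.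

Lemma mxstarM (X Y : 'M[A]_n) : mxstar (X * Y) = mxstar Y * mxstar X.
Proof.
apply/matrixP => i j; rewrite !mxE (big_morph _ starD star0).
by apply: eq_bigr => k _; rewrite !mxE starM.
Qed.

HB.instance Definition _ := isStarRing.Build 'M[A]_n mxstarK mxstarD mxstarM.

End MatrixStar.

(* The norm is a field of the mixin and not the one of a normedModType:
   Hierarchy-Builder cannot join normedModType and algType without changing
   the ancestors of numDomainType. *)
HB.mixin Record StarRing_isCStarAlgebra (R : realType) A
    & StarRing A & GRing.Algebra R[i] A := {
  starZ : forall (c : R[i]) (x : A), star (c *: x) = c^* *: star x;
  cnorm : A -> R;
  cnorm0_eq0 : forall x : A, cnorm x = 0 -> x = 0;
  cnormD : forall x y : A, cnorm (x + y) <= cnorm x + cnorm y;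
  cnormZ : forall (c : R[i]) (x : A),
    (cnorm (c *: x))%:C%C = `|c| * (cnorm x)%:C%C;
  cnormM : forall x y : A, cnorm (x * y) <= cnorm x * cnorm y;
  cnorm_star : forall x : A, cnorm (star x * x) = cnorm x ^+ 2;
  cnorm_complete : forall u : nat -> A,
    (forall e : R, 0 < e -> exists N : nat, forall p q : nat,
       (N <= p)%N -> (N <= q)%N -> cnorm (u p - u q) < e) ->
    exists l : A, forall e : R, 0 < e -> exists N : nat, forall p : nat,
       (N <= p)%N -> cnorm (u p - l) < e
}.

#[short(type="cstarAlgType")]
HB.structure Definition CStarAlgebra (R : realType) :=
  {A of StarRing_isCStarAlgebra R A & StarRing A & GRing.Algebra R[i] A}.

(* [inner x y] is linear in [x] and conjugate-linear in [y]. *)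
HB.mixin Record NormedModule_isPreHilbert (R : realType) K
    & NormedModule R[i] K := {
  inner : {dot K for Num.conj};
  sqr_norm_inner : forall x : K, `|x| ^+ 2 = inner x x
}.

#[short(type="preHilbertType")]
HB.structure Definition PreHilbert (R : realType) :=
  {K of NormedModule_isPreHilbert R K & NormedModule R[i] K}.

#[short(type="hilbertType")]
HB.structure Definition Hilbert (R : realType) :=
  {K of PreHilbert R K & CompleteNormedModule R[i] K}.

Section ComplexPreHilbert.
Variable R : realType.

Definition cinner (x y : R[i]^o) : R[i] := (x : R[i]) * (y : R[i])^*.

Lemma cinner_bilinear :
  bilinear_for ( *%R : GRing.Scale.law R[i] R[i])
    (Num.conj \; *%R : GRing.Scale.law R[i] R[i]) cinner.
Proof.
split=> u a x y; rewrite /cinner /=; first by rewrite mulrDl mulrA.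
by rewrite rmorphD rmorphM mulrDr mulrCA.
Qed.

HB.instance Definition _ :=
  @bilinear_isBilinear.Build R[i] R[i]^o R[i]^o R[i] _ _ cinner cinner_bilinear.

Lemma cinner_hermitian x y : cinner x y = (-1) ^+ false * (cinner y x)^*.
Proof. by rewrite mul1r /cinner rmorphM /= conjCK mulrC. Qed.

HB.instance Definition _ :=
  @isHermitianSesquilinear.Build R[i] R[i]^o false Num.conj cinner
    cinner_hermitian.

Lemma cinner_gt0 (x : R[i]^o) : x != 0 -> 0 < cinner x x.
Proof. by move=> x0; rewrite /cinner mul_conjC_gt0. Qed.

HB.instance Definition _ := @isDotProduct.Build R[i] R[i]^o cinner cinner_gt0.

Lemma sqr_norm_cinner (x : R[i]^o) : `|x| ^+ 2 = cinner x x.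
Proof. exact: normCK. Qed.

HB.instance Definition _ :=
  @NormedModule_isPreHilbert.Build R R[i]^o
    (cinner : {dot R[i]^o for Num.conj}) sqr_norm_cinner.

End ComplexPreHilbert.

Section Operators.
Variable R : realType.

Definition is_adjoint (H K : preHilbertType R) (V : H -> K) (W : K -> H) :=
  forall x y, inner (V x) y = inner x (W y).

Definition adjoint (H K : preHilbertType R) (V : H -> K) : K -> H :=
  xget (fun=> 0) [set W | is_adjoint V W].

(* Over the complex numbers [0 <= z] entails that [z] is real, hence
   [op_le S T] entails that [T - S] is self-adjoint when it is bounded. *)
Definition op_le (K : preHilbertType R) (S T : K -> K) :=
  forall x, 0 <= inner (T x - S x) x.

Definition lin_span (K : lmodType R[i]) (S : set K) : set K :=
  [set x | exists (N : nat) (c : 'I_N -> R[i]) (v : 'I_N -> K),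
     (forall l, S (v l)) /\ x = \sum_(l < N) c l *: v l].

Record star_rep (A : cstarAlgType R) (K : hilbertType R)
    (p : A -> {linear K -> K}) : Prop := StarRep {
  star_rep_bounded : forall a, continuous (p a);
  star_repD : forall a b x, p (a + b) x = p a x + p b x;
  star_repZ : forall (c : R[i]) a x, p (c *: a) x = c *: p a x;
  star_repM : forall a b x, p (a * b) x = p a (p b x);
  star_rep1 : forall x, p 1 x = x;
  star_rep_star : forall a, is_adjoint (p a) (p (star a))
}.

End Operators.

(* A tuple (x_1, ..., x_k) is a function on 'I_k: [l : 'I_k] is the position
   l + 1, and [rev_ord l] is the position of the mirror image x_(k - l). *)

Definition multilinear (F : nzRingType) (A : lmodType F) (k : nat)
    (f : ('I_k -> A) -> F) :=
  forall (l : 'I_k) (a : 'I_k -> A) (c : F) (x y : A),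
    f [eta a with l |-> c *: x + y] =
    c * f [eta a with l |-> x] + f [eta a with l |-> y].

(* The sum is over the paths i = r_0, r_1, ..., r_k = j. *)
Definition block (A : Type) (B : nmodType) (k n : nat)
    (phi : 'I_n -> 'I_n -> ('I_k -> A) -> B) (X : 'I_k -> 'M[A]_n) : 'M[B]_n :=
  \matrix_(i, j)
    \sum_(r : {ffun 'I_k.+1 -> 'I_n} | (r ord0 == i) && (r ord_max == j))
      phi i j (fun l => X l (r (widen_ord (leqnSn k) l)) (r (lift ord0 l))).

Definition amplification (A : Type) (B : nmodType) (k t : nat)
    (Phi : ('I_k -> A) -> B) : ('I_k -> 'M[A]_t) -> 'M[B]_t :=
  block (fun _ _ : 'I_t => Phi).

(* In a C*-algebra this is equivalent to being self-adjoint with spectrum in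
   [0, +oo[; it is used for matrices over a C*-algebra, where the norm plays no
   role. *)
Definition star_pos (A : starRingType) (x : A) := exists y : A, x = star y * y.

(* [k = l.*2.+1] holds exactly when k is odd and l is the middle position. *)
Definition positive_map (C D : starRingType) (k : nat)
    (Phi : ('I_k -> C) -> D) :=
  forall X : 'I_k -> C,
    (forall l, X l = star (X (rev_ord l))) ->
    (forall l : 'I_k, k = l.*2.+1 -> star_pos (X l)) ->
    star_pos (Phi X).

Definition completely_positive (C D : starRingType) (k : nat)
    (Phi : ('I_k -> C) -> D) :=
  forall t : nat, positive_map (amplification (t := t) Phi).

(* The positions l < k./2 are the first m - 1 ones when k = 2m - 1 and the
   first m ones when k = 2m. *)
Definition invariant_map (C : pzRingType) (D : Type) (k : nat)
    (Phi : ('I_k -> C) -> D) :=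
  forall X Y : 'I_k -> C,
    Phi (fun l => if (l < k./2)%N then X l * Y l else X l) =
    Phi (fun l => if (rev_ord l < k./2)%N then Y (rev_ord l) * X l else X l).

Section StinespringTriples.
Variables (R : realType) (A : cstarAlgType R) (n k : nat).

Record icp_block (phi : 'I_n -> 'I_n -> ('I_k -> A) -> R[i]) : Prop :=
  ICPBlock {
    icp_multilinear : forall i j, multilinear (phi i j);
    icp_invariant : invariant_map (block phi);
    icp_completely_positive : completely_positive (block phi)
  }.

Definition icp_le (psi phi : 'I_n -> 'I_n -> ('I_k -> A) -> R[i]) :=
  icp_block (fun i j a => phi i j a - psi i j a).

Lemma half_succ_le : ((k.+1)./2 <= k)%N.
Proof. by rewrite leq_half_double ltnS -addnn leq_addr. Qed.

(* With m = (k + 1)./2, this is the argument of pi_(s + 1): the product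
   a_(m - s) a_(k + 1 - m + s), which is a_(m - s) a_(m + s) for k = 2m - 1 and
   a_(m - s) a_(m + 1 + s) for k = 2m, except that it is the single factor a_m
   when both positions coincide, i.e. when k = 2m - 1 and s = 0. *)
Definition folded_arg (a : 'I_k -> A) (s : 'I_(k.+1)./2) : A :=
  let l := widen_ord half_succ_le (rev_ord s) in
  if l == rev_ord l then a l else a l * a (rev_ord l).

Variable K : hilbertType R.
Variables (pi : 'I_(k.+1)./2 -> A -> {linear K -> K}).
Variable V : 'I_n -> {linear R[i]^o -> K}.

Definition rep_prod (b : 'I_(k.+1)./2 -> A) : K -> K :=
  \big[comp/idfun]_(s < (k.+1)./2) (pi s (b s) : K -> K).

(* The operator on the one-dimensional Hilbert space R[i]^o is identified with
   its value at 1. *)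
Definition stinespring_form (T : K -> K) (i j : 'I_n) (a : 'I_k -> A) : R[i] :=
  adjoint (V i) (T (rep_prod (folded_arg a) (V j 1))).

Record stinespring_triple (phi : 'I_n -> 'I_n -> ('I_k -> A) -> R[i]) : Prop :=
  StinespringTriple {
    stinespring_rep : forall s, star_rep (pi s);
    stinespring_comm : forall s t, s != t ->
      forall a b x, pi s a (pi t b x) = pi t b (pi s a x);
    stinespring_bounded : forall i, continuous (V i);
    stinespringE : forall i j a, phi i j a = stinespring_form idfun i j a
  }.

Definition minimal_triple :=
  closure (lin_span [set x |
    exists b h, x = rep_prod b (\sum_(i < n) V i (h i))]) = [set: K].

Definition in_commutant (T : K -> K) :=
  forall s a x, pi s a (T x) = T (pi s a x).

End StinespringTriples.

(* Main.v *)
Require Import Defs.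
From HB Require Import structures.
From mathcomp Require Import all_boot all_order all_algebra sesquilinear.
From mathcomp Require Import complex.
From mathcomp Require Import all_classical all_reals all_analysis.
From mathcomp Require Import ring lra zify.
Set Implicit Arguments.
Unset Strict Implicit.
Unset Printing Implicit Defensive.
Import Order.TTheory GRing.Theory Num.Theory.
Import numFieldNormedType.Exports.
Local Open Scope ring_scope.
Local Open Scope classical_set_scope.

(** With m = floor((k + 1) / 2), invariance shows that psi_ij(a) depends only on
    the m folded products that are the arguments of pi_1, ..., pi_m.  On tuples
    c, b of length m it is thus determined by the kernel
      psi_ij(c_m^*, ..., c_1^*, b_1, ..., b_m)
    (middle entry c_1^* b_1 when k is odd), which for phi equals
    <pi(b) V_j, pi(c) V_i> where pi(b) = pi_1(b_1) ... pi_m(b_m).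

    If psi <= phi, evaluating the amplifications of psi and phi - psi on
    suitable matrices shows that 0 <= D_psi <= D_phi as kernels on the
    generators pi(b) V_j of a dense subspace of K.  A positive kernel dominated
    by the Gram kernel of a total family comes from an operator 0 <= T <= I, by
    Riesz representation, and the identity psi(c, a b) = psi(a^* c, b) says that
    T commutes with each pi_s.

    Conversely the entries of an amplification of phi - psi are sums over paths
    of length k; cutting the paths in the middle turns its quadratic form into
    sum_c <(I - T) E_c, E_c>, and a positive semidefinite complex matrix is a
    Gram matrix by the spectral theorem. *)

(** * Norms and inner products *)

(** For [a > 0], evaluate at the vertex [- b / a]. For [a = 0] the expression is affine in [t] and
    takes the value -1 somewhere unless [b = 0]. Both Cauchy-Schwarz inequalities below rest on
    this, and with [c = 0] it forces a first variation to vanish. *)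
Lemma discriminant_le (R : realType) (a b c : R) :
  0 <= a -> (forall t, 0 <= a * t ^+ 2 + b * t *+ 2 + c) -> b ^+ 2 <= a * c.
Proof.
rewrite le_eqVlt => /predU1P[<- | a0] H.
  rewrite mul0r; have [-> | b0] := eqVneq b 0; first by rewrite expr0n.
  have := H (- (c + 1) / (b *+ 2)).
  have -> : 0 * (- (c + 1) / (b *+ 2)) ^+ 2 + b * (- (c + 1) / (b *+ 2)) *+ 2 + c = - 1.
    by field; rewrite b0.
  by rewrite ler0N1.
have := H (- b / a).
have -> : a * (- b / a) ^+ 2 + b * (- b / a) *+ 2 + c = (a * c - b ^+ 2) / a.
  by field; rewrite gt_eqF.
by rewrite pmulr_lge0 ?invr_gt0 // subr_ge0.
Qed.

Lemma ReD (R : realType) (z w : R[i]) : complex.Re (z + w) = complex.Re z + complex.Re w.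
Proof. by case: z; case: w. Qed.

Lemma ReN (R : realType) (z : R[i]) : complex.Re (- z) = - complex.Re z.
Proof. by case: z. Qed.

Lemma ReZ (R : realType) (t : R) (z : R[i]) : complex.Re (t%:C%C * z) = t * complex.Re z.
Proof. by case: z => u v /=; rewrite mul0r subr0. Qed.

Section PreHilbert.
Variables (R : realType) (K : hilbertType R).
Implicit Types (x y z : K) (a : R[i]).

(** The norm takes values in [R[i]]; this real-valued copy gives access to the total order and to
    real arithmetic. *)
Definition nrm x : R := complex.Re `|x|.

Lemma nrmE x : `|x| = (nrm x)%:C%C.
Proof. by rewrite /nrm RRe_real ?normr_real. Qed.

Lemma nrm_ge0 x : 0 <= nrm x.
Proof. by rewrite -lecR -nrmE; exact: normr_ge0. Qed.

Lemma nrm0_eq0 x : nrm x = 0 -> x = 0.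
Proof. by move=> x0; apply/normr0_eq0; rewrite nrmE x0. Qed.

Lemma nrmD x y : nrm (x + y) <= nrm x + nrm y.
Proof. by have := ler_normD x y; rewrite !nrmE -rmorphD lecR. Qed.

Lemma nrmN x : nrm (- x) = nrm x.
Proof. by rewrite /nrm normrN. Qed.

Lemma nrm_distC x y : nrm (x - y) = nrm (y - x).
Proof. by rewrite /nrm distrC. Qed.

Lemma innerDl x y z : inner (x + y) z = inner x z + inner y z.
Proof. exact: linearDl. Qed.

Lemma innerDr x y z : inner z (x + y) = inner z x + inner z y.
Proof. exact: linearDr. Qed.

Lemma innerNl x z : inner (- x) z = - inner x z.
Proof. exact: linearNl. Qed.

Lemma innerNr x z : inner z (- x) = - inner z x.
Proof. exact: linearNr. Qed.

Lemma innerZl a x z : inner (a *: x) z = a * inner x z.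
Proof. exact: linearZl_LR. Qed.

Lemma innerZr a x z : inner z (a *: x) = a^* * inner z x.
Proof. exact: linearZr_LR. Qed.

Lemma inner_suml I (r : seq I) (P : pred I) (E : I -> K) z :
  inner (\sum_(i <- r | P i) E i) z = \sum_(i <- r | P i) inner (E i) z.
Proof. exact: linear_sumlz. Qed.

Lemma inner_sumr I (r : seq I) (P : pred I) (E : I -> K) z :
  inner z (\sum_(i <- r | P i) E i) = \sum_(i <- r | P i) inner z (E i).
Proof. exact: linear_sumr. Qed.

Lemma innerC x y : inner x y = (inner y x)^*.
Proof. by rewrite hermC expr0 mul1r. Qed.

Lemma Re_innerC x y : complex.Re (inner x y) = complex.Re (inner y x).
Proof. by rewrite innerC; case: (inner y x). Qed.

Lemma inner_self x : inner x x = (nrm x ^+ 2)%:C%C.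
Proof. by rewrite -sqr_norm_inner nrmE rmorphXn. Qed.

Lemma Re_inner_self x : complex.Re (inner x x) = nrm x ^+ 2.
Proof. by rewrite inner_self. Qed.

Lemma nrm_sqrD x y :
  nrm (x + y) ^+ 2 = nrm x ^+ 2 + complex.Re (inner x y) *+ 2 + nrm y ^+ 2.
Proof.
rewrite -!Re_inner_self innerDl !innerDr !ReD (Re_innerC y x) mulr2n.
by rewrite !addrA.
Qed.

Lemma nrm_sqrZ (t : R) x : nrm (t%:C%C *: x) ^+ 2 = t ^+ 2 * nrm x ^+ 2.
Proof.
rewrite -!Re_inner_self innerZl innerZr ReZ.
have -> : (t%:C%C)^* = t%:C%C by exact: conjc_real.
by rewrite ReZ mulrA expr2.
Qed.

Lemma Re_inner_le x y : complex.Re (inner x y) <= nrm x * nrm y.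
Proof.
have h : complex.Re (inner x y) ^+ 2 <= (nrm x * nrm y) ^+ 2.
  rewrite exprMn; apply: discriminant_le => [|t]; first exact: sqr_ge0.
  have := sqr_ge0 (nrm (t%:C%C *: x + y)).
  by rewrite nrm_sqrD nrm_sqrZ innerZl ReZ mulrC [t * _]mulrC.
rewrite (le_trans (ler_norm _)) // -ler_sqr ?nnegrE ?normr_ge0 //.
  by rewrite real_normK // num_real.
by rewrite mulr_ge0 ?nrm_ge0.
Qed.

Lemma normr_Re_inner_le x y : `|complex.Re (inner x y)| <= nrm x * nrm y.
Proof. by rewrite ler_norml lerNl -ReN -innerNl -{1}(nrmN x) !Re_inner_le. Qed.

End PreHilbert.

(** * Riesz representation on a span *)

Lemma nrm_complete (R : realType) (K : hilbertType R) (u : nat -> K) :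
  (forall e : R, 0 < e -> exists N : nat, forall p q : nat,
     (N <= p)%N -> (N <= q)%N -> nrm (u p - u q) < e) ->
  exists l : K, forall e : R, 0 < e -> exists N : nat, forall p : nat,
     (N <= p)%N -> nrm (u p - l) < e.
Proof.
move=> hu.
have cu : cauchy (u @ \oo).
  apply/cauchy_exP => e e0.
  have eR : e \is Num.real by rewrite gtr0_real.
  have [|N hN] := hu (complex.Re e).
    by move: e0; rewrite ltcE => /andP[_].
  exists (u N), N => // p /= Np.
  by rewrite -ball_normE /ball_ /= nrmE -(RRe_real eR) ltcR hN.
have /cauchy_cvg/cvgrPdist_lt hl := cu.
exists (lim (u @ \oo)) => e e0.
have [|N _ hN] := hl e%:C%C; first by rewrite ltcR.
exists N => p Np; have := hN p Np.
by rewrite nrmE nrm_distC ltcR.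
Qed.

Section Combinations.
Variables (F : nzRingType) (G : Type).
Implicit Types s t : seq (F * G).

(** Combinations are formal lists: any function on [G] extends to them with no well-definedness
    check, even when the vectors [v g] are linearly dependent. *)
Definition lincomb (V : lmodType F) (v : G -> V) s : V :=
  \sum_(p <- s) p.1 *: v p.2.

Definition scale_comb (a : F) s := [seq (a * p.1, p.2) | p <- s].

Lemma lincomb_cat (V : lmodType F) (v : G -> V) s t :
  lincomb v (s ++ t) = lincomb v s + lincomb v t.
Proof. exact: big_cat. Qed.

Lemma lincombZ (V : lmodType F) (v : G -> V) a s :
  lincomb v (scale_comb a s) = a *: lincomb v s.
Proof.
rewrite /lincomb big_map scaler_sumr; apply: eq_bigr => p _.
by rewrite scalerA.
Qed.

Lemma lincomb1 (V : lmodType F) (v : G -> V) g : lincomb v [:: (1, g)] = v g.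
Proof. by rewrite /lincomb big_seq1 scale1r. Qed.

End Combinations.

Lemma inner_lincombl (R : realType) (K : hilbertType R) (G : Type) (v : G -> K)
    (s : seq (R[i] * G)) (y : K) :
  inner (lincomb v s) y = \sum_(p <- s) p.1 * inner (v p.2) y.
Proof. by rewrite inner_suml; apply: eq_bigr => p _; rewrite innerZl. Qed.

Lemma inner_lincombr (R : realType) (K : hilbertType R) (G : Type) (v : G -> K)
    (s : seq (R[i] * G)) (y : K) :
  inner y (lincomb v s) = \sum_(p <- s) (p.1)^* * inner y (v p.2).
Proof. by rewrite inner_sumr; apply: eq_bigr => p _; rewrite innerZr. Qed.

Lemma exists_natSinv_lt (R : realType) (e : R) : 0 < e ->
  exists N : nat, forall n : nat, (N <= n)%N -> n.+1%:R^-1 < e.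
Proof.
move=> e0; have [N _ hN] := near_infty_natSinv_lt (PosNum e0).
by exists N => n /hN.
Qed.

Lemma parallelogram (R : realType) (K : hilbertType R) (x y : K) :
  nrm (x - y) ^+ 2 = nrm x ^+ 2 *+ 2 + nrm y ^+ 2 *+ 2 - nrm (x + y) ^+ 2.
Proof. by rewrite !nrm_sqrD innerNr nrmN ReN; ring. Qed.

(* [w] is the limit of a sequence of combinations minimising
   [|x|^2 - 2 Re (f x)]; the span of [v] need not be closed, and [f] is only
   linear on formal combinations until the bound is used. *)
Lemma riesz_span (R : realType) (K : hilbertType R) (G : Type) (v : G -> K)
    (f : G -> R[i]^o) (c : R) : 0 <= c ->
  (forall s, complex.Re (lincomb f s) <= c * nrm (lincomb v s)) ->
  exists w, forall g, inner (v g) w = f g.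
Proof.
move=> c0 hf.
pose J s := nrm (lincomb v s) ^+ 2 - complex.Re (lincomb f s) *+ 2.
(* With x the combination of [s], J s >= |x|^2 - 2 c |x| = (|x| - c)^2 - c^2. *)
have J_lb s : - c ^+ 2 <= J s.
  have := hf s; have := sqr_ge0 (nrm (lincomb v s) - c); rewrite /J.
  by move: (nrm _) (complex.Re _) => x y; nra.
have Jinf : has_inf (range J).
  by split; [exists (J [::]), [::] | exists (- c ^+ 2) => _ [s _ <-]].
pose mu := inf (range J).
have mu_le s : mu <= J s by apply: ge_inf; [case: Jinf | exists s].
have /choice[y hy] (n : nat) : exists s, J s < mu + n.+1%:R^-1.
  have n0 : (0 : R) < n.+1%:R^-1 by rewrite invr_gt0.
  by have [_ [s _ <-] Hs] := inf_adherent n0 Jinf; exists s.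
have half_C : (2^-1 : R[i]) = (2^-1 : R)%:C%C by rewrite rmorphV ?unitfE// rmorph_nat.
have [e e0|w hw] := nrm_complete (u := fun n => lincomb v (y n)).
  (* By the parallelogram law the squared distance of two terms is 2 J(p) + 2 J(q) - 4 J(midpoint),
     which is below 2/(p+1) + 2/(q+1). *)
  have [|N hN] := @exists_natSinv_lt R (e ^+ 2 / 4); first by rewrite divr_gt0 ?exprn_gt0.
  exists N => p q Np Nq.
  rewrite -ltr_sqr ?nnegrE ?nrm_ge0 ?ltW // parallelogram.
  have := mu_le (scale_comb 2^-1 (y p ++ y q)).
  rewrite {1}/J !lincombZ half_C nrm_sqrZ ReZ !lincomb_cat ReD.
  have := hy p; have := hy q; have := hN _ Np; have := hN _ Nq; rewrite /J.
  have -> : (2^-1 : R) ^+ 2 = 4^-1 by rewrite exprVn -natrX.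
  move: (nrm _ ^+ 2) (nrm _ ^+ 2) (nrm _ ^+ 2) (e ^+ 2) => A B S E.
  move: (complex.Re _) (complex.Re _) (q.+1%:R^-1) (p.+1%:R^-1) => X Y Z W.
  lra.
exists w => g.
(* Real parts for the multiples [z = 1] and [z = 'i] determine the complex value. *)
suff key (z : R[i]) : complex.Re (inner w (z *: v g)) = complex.Re (z * f g).
  have := key 1; have := key 'i%C; rewrite scale1r mul1r.
  rewrite Re_innerC innerZl [complex.Re (inner w _)]Re_innerC.
  case: (inner (v g) w) (f g) => [a b] [a' b'] /=.
  by rewrite !mul0r !mul1r !sub0r => /oppr_inj -> ->.
set u := z *: v g; set d := complex.Re (inner w u) - complex.Re (z * f g).
(* Minimality along the line w + t u means t^2 |u|^2 + 2 t d >= 0 for all real t, hence d = 0. As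
   [w] need not be a combination, the inequality is proved up to [e] by means of [y n]. *)
suff : d ^+ 2 <= nrm u ^+ 2 * 0.
  by rewrite mulr0 => d2; apply/eqP; rewrite -subr_eq0 -sqrf_eq0 eq_le d2 sqr_ge0.
apply: discriminant_le => [|t]; first exact: sqr_ge0.
rewrite addr0; apply/ler_addgt0Pl => e e0.
(* [y n] misses the infimum by less than [e / 2], and replacing it by [w] costs at most another
   [e / 2]. The summand 1 keeps [b] positive when [t] or [u] vanishes. *)
set b := 2 * `|t| * nrm u + 1.
have b0 : 0 < b by rewrite ltr_wpDl // !mulr_ge0 ?nrm_ge0.
have [|N hN] := @exists_natSinv_lt R (e / 2); first by rewrite divr_gt0.
have [|M hM] := hw (e / 2 / b); first by rewrite !divr_gt0.
set n := maxn N M; have {}hN := hN n (leq_maxl _ _); have {}hM := hM n (leq_maxr _ _).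
have := mu_le (y n ++ scale_comb t%:C%C (scale_comb z [:: (1, g)])).
rewrite {1}/J lincomb_cat !lincombZ lincomb1 nrm_sqrD nrm_sqrZ.
rewrite lincomb_cat !lincombZ lincomb1 ReD [_ *: (z *: _)]/GRing.scale /= ReZ.
rewrite -/u Re_innerC innerZl ReZ Re_innerC.
have := hy n; rewrite /J => hJ hmu.
have h1 : t * (complex.Re (inner (lincomb v (y n)) u) - complex.Re (inner w u)) <= e / 2 / 2.
  rewrite -ReN -ReD -innerNl -innerDl.
  apply: le_trans (ler_norm _) _; rewrite normrM.
  have := normr_Re_inner_le (lincomb v (y n) - w) u.
  move/(ler_wpM2l (normr_ge0 t))/le_trans; apply.
  rewrite mulrCA [e / 2 / 2](_ : _ = e / 2 / b * (b / 2)).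
    apply: ler_pM; [exact: nrm_ge0 | by rewrite mulr_ge0 ?nrm_ge0 | exact: ltW |].
    by rewrite ler_pdivlMr // /b -mulrA mulrC ler_wpDr.
  by field; rewrite gt_eqF.
move: hJ hmu h1 hN; rewrite /d.
move: (nrm _ ^+ 2) (nrm _ ^+ 2) (complex.Re _) (complex.Re _)
  (complex.Re _) (complex.Re _) => A B C D E F.
move: (n.+1%:R^-1) => Z; nra.
Qed.

(** * Operators from dominated kernels *)

Lemma bounded_linear_nrm_continuous (R : realType) (K L : hilbertType R)
    (T : {linear K -> L}) (c : R) :
  (forall x, nrm (T x) <= c * nrm x) -> continuous T.
Proof.
move=> hT; apply: bounded_linear_continuous.
exists `|c|%:C%C; split; first by rewrite ger0_real // lecR.
move=> M cM; apply/nbhs_ballP; exists 1; [exact: ltr01 | move=> x].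
rewrite -ball_normE /ball_ /= sub0r normrN nrmE -[1]/(1%:C%C) ltcR => x1.
rewrite (le_trans _ (ltW cM)) // nrmE lecR (le_trans (hT x)) //.
apply: (@le_trans _ _ (`|c| * nrm x)).
  by rewrite ler_wpM2r ?nrm_ge0 ?ler_norm.
by rewrite -[leRHS]mulr1 ler_wpM2l // ltW.
Qed.

Lemma complex_ge0 (R : realType) (z : R[i]) :
  complex.Im z = 0 -> 0 <= complex.Re z -> 0 <= z.
Proof. by rewrite lecE /= => -> ->; rewrite eqxx. Qed.

Section DominatedKernel.
Variables (R : realType) (K : hilbertType R) (G : Type) (v : G -> K).
Hypothesis dense_v : forall (x : K) (e : R), 0 < e ->
  exists s, nrm (x - lincomb v s) < e.

(** If q x < 0, a combination closer to x than -q x / (|c| + 1) would have a negative value. The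
    constant may depend on x, as it must for quadratic forms, which are only locally Lipschitz. *)
Lemma dense_ge0 (q : K -> R) :
  (forall x, exists c, forall y, nrm (x - y) <= 1 ->
     q y <= q x + c * nrm (x - y)) ->
  (forall s, 0 <= q (lincomb v s)) -> forall x, 0 <= q x.
Proof.
move=> q_cont q_ge0 x; rewrite leNgt; apply/negP => qx.
have [c hc] := q_cont x.
have c1 : 0 < `|c| + 1 by rewrite ltr_wpDl.
have [|s] := @dense_v x (Num.min 1 (- q x / (`|c| + 1))).
  by rewrite lt_min ltr01 divr_gt0 // oppr_gt0.
rewrite lt_min => /andP[/ltW s1]; rewrite ltr_pdivlMr // => s2.
have := le_trans (q_ge0 s) (hc _ s1).
have : c * nrm (x - lincomb v s) <= `|c| * nrm (x - lincomb v s).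
  by rewrite ler_wpM2r ?nrm_ge0 ?ler_norm.
by have := nrm_ge0 (x - lincomb v s); move: s2; move: (nrm _) => N; nra.
Qed.

(** By density the bound also holds with [u] in place of the combination, where it reads |u|^2 <= c
    |u|. *)
Lemma dense_nrm_le (u : K) (c : R) : 0 <= c ->
  (forall s, complex.Re (inner (lincomb v s) u) <= c * nrm (lincomb v s)) ->
  nrm u <= c.
Proof.
move=> c0 hc.
have : 0 <= c * nrm u - complex.Re (inner u u).
  apply: (@dense_ge0 (fun y => c * nrm y - complex.Re (inner y u))) => [x|s].
    exists (c + nrm u) => y _.
    have h1 : nrm y <= nrm x + nrm (x - y).
      by rewrite -{1}[y](subKr x) addrC [nrm x + _]addrC (le_trans (nrmD _ _)) // nrmN.
    have := Re_inner_le (x - y) u; rewrite innerDl innerNl ReD ReN => h2.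
    by have := ler_wpM2l c0 h1; move: h2; rewrite !mulrDr !mulrDl; lra.
  by rewrite subr_ge0.
rewrite subr_ge0 Re_inner_self expr2.
have := nrm_ge0 u; rewrite le_eqVlt => /predU1P[<- //|u0].
by rewrite ler_pM2r.
Qed.

Lemma dense_inner_inj (u u' : K) :
  (forall g, inner (v g) u = inner (v g) u') -> u = u'.
Proof.
move=> h; apply/subr0_eq/nrm0_eq0/eqP; rewrite eq_le nrm_ge0 andbT.
apply: dense_nrm_le => // s; rewrite mul0r.
rewrite inner_lincombl big1 // => p _.
by rewrite innerDr innerNr h subrr mulr0.
Qed.

Variable D : G -> G -> R[i].

Definition kernel_form (s t : seq (R[i] * G)) : R[i] :=
  \sum_(p <- s) \sum_(q <- t) p.1 * (q.1)^* * D p.2 q.2.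

Lemma kernel_form_catl s s' t :
  kernel_form (s ++ s') t = kernel_form s t + kernel_form s' t.
Proof. exact: big_cat. Qed.

Lemma kernel_form_catr s t t' :
  kernel_form s (t ++ t') = kernel_form s t + kernel_form s t'.
Proof.
by rewrite /kernel_form -big_split; apply: eq_bigr => p _; rewrite big_cat.
Qed.

Lemma kernel_formZl a s t :
  kernel_form (scale_comb a s) t = a * kernel_form s t.
Proof.
rewrite /kernel_form big_map mulr_sumr; apply: eq_bigr => p _.
by rewrite mulr_sumr; apply: eq_bigr => q _; rewrite !mulrA.
Qed.

Lemma kernel_formZr a s t :
  kernel_form s (scale_comb a t) = a^* * kernel_form s t.
Proof.
rewrite /kernel_form mulr_sumr; apply: eq_bigr => p _.
rewrite big_map mulr_sumr; apply: eq_bigr => q _ /=.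
by rewrite rmorphM !mulrA [a^* * _]mulrC.
Qed.

Hypothesis form_ge0 : forall s, 0 <= kernel_form s s.
Hypothesis form_le : forall s,
  kernel_form s s <= inner (lincomb v s) (lincomb v s).

(** Polarization: the form is real at s + z t, so its cross terms have no imaginary part; take
    [z = 1] and [z = 'i]. *)
Lemma kernel_formC s t : kernel_form t s = (kernel_form s t)^*.
Proof.
have Im0 (z : R[i]) : complex.Im (z^* * kernel_form s t + z * kernel_form t s) = 0.
  have := form_ge0 (s ++ scale_comb z t).
  rewrite kernel_form_catl !kernel_form_catr !kernel_formZl !kernel_formZr.
  have := form_ge0 s; have := form_ge0 t.
  case: (kernel_form s s) => a b; case: (kernel_form t t) => a' b'.
  rewrite !lecE /= => /andP[/eqP-> _] /andP[/eqP-> _].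
  case: (kernel_form s t) (kernel_form t s) z => p q [p' q'] [x y] /= /andP[/eqP + _].
  by move=> <-; ring.
have := Im0 1; have := Im0 'i%C.
case: (kernel_form s t) (kernel_form t s) => p q [p' q'] /= h1 h2.
by apply/eqP; rewrite eq_complex /=; apply/andP; split; apply/eqP; lra.
Qed.

(** Cauchy-Schwarz for the positive form, followed by its domination by the Gram form. *)
Lemma Re_kernel_form_le s t :
  complex.Re (kernel_form s t) <= nrm (lincomb v s) * nrm (lincomb v t).
Proof.
have le_sqr u : complex.Re (kernel_form u u) <= nrm (lincomb v u) ^+ 2.
  by have := form_le u; rewrite inner_self lecE => /andP[_].
have ge_0 u : 0 <= complex.Re (kernel_form u u).
  by have := form_ge0 u; rewrite lecE => /andP[_].
have h : complex.Re (kernel_form s t) ^+ 2 <=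
    (nrm (lincomb v s) * nrm (lincomb v t)) ^+ 2.
  rewrite exprMn (le_trans _ (ler_pM _ _ (le_sqr s) (le_sqr t))) //.
  apply: discriminant_le => // x.
  have := ge_0 (scale_comb x%:C%C s ++ t).
  rewrite kernel_form_catl !kernel_form_catr !kernel_formZl !kernel_formZr.
  rewrite (kernel_formC s t) !ReD.
  have -> : (x%:C%C)^* = x%:C%C by exact: conjc_real.
  rewrite !ReZ; congr (_ <= _).
  by case: (kernel_form s t) => p q /=; ring.
rewrite (le_trans (ler_norm _)) // -ler_sqr ?nnegrE ?normr_ge0 //.
  by rewrite real_normK // num_real.
by rewrite mulr_ge0 ?nrm_ge0.
Qed.

(* Riesz gives first the vectors [w h = T (v h)], then, for arbitrary [x], the
   vector [T x] as the representative of [v g |-> <w g, x>]. *)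
Lemma kernel_operator :
  exists T : {linear K -> K},
    [/\ continuous T, op_le \0 T, op_le T idfun,
      forall x y, inner (T x) y = inner x (T y)
      & forall g h, inner (T (v g)) (v h) = D g h].
Proof.
have /choice[w hw] h : exists w, forall g, inner (v g) w = D g h.
  apply: (riesz_span (c := nrm (v h))) => [|s]; first exact: nrm_ge0.
  have := Re_kernel_form_le s [:: (1, h)].
  rewrite lincomb1 mulrC; congr (complex.Re _ <= _).
  by apply: eq_bigr => p _; rewrite big_seq1 rmorph1 mulr1.
have inner_w s t : inner (lincomb v s) (lincomb w t) = kernel_form s t.
  rewrite inner_lincombl; apply: eq_bigr => p _.
  rewrite inner_lincombr mulr_sumr; apply: eq_bigr => q _.
  by rewrite hw mulrA.
have w_le s : nrm (lincomb w s) <= nrm (lincomb v s).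
  apply: dense_nrm_le => [|t]; first exact: nrm_ge0.
  by rewrite inner_w mulrC Re_kernel_form_le.
have [T hT] : exists T : {linear K -> K}, forall x g,
    inner (v g) (T x) = inner (w g) x.
  have /choice[T hT] x : exists u, forall g, inner (v g) u = inner (w g) x.
    apply: (riesz_span (c := nrm x)) => [|s]; first exact: nrm_ge0.
    have -> : lincomb (fun g => inner (w g) x : R[i]^o) s = inner (lincomb w s) x.
      by rewrite inner_lincombl.
    by rewrite (le_trans (Re_inner_le _ _)) // mulrC ler_wpM2l ?nrm_ge0.
  have T_lin : linear T.
    move=> a x y; apply: dense_inner_inj => g.
    by rewrite hT innerDr innerZr innerDr innerZr !hT.
  by exists (HB.pack T (GRing.isLinear.Build _ _ _ _ T T_lin) : {linear K -> K}).
have T_v g : T (v g) = w g.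
  apply: dense_inner_inj => h; rewrite hT hw innerC hw.
  have := kernel_formC [:: (1, g)] [:: (1, h)].
  by rewrite /kernel_form !big_seq1 rmorph1 !mul1r.
have T_comb s : T (lincomb v s) = lincomb w s.
  rewrite /lincomb linear_sum; apply: eq_bigr => p _.
  by rewrite linearZ /= T_v.
have T_le x : nrm (T x) <= nrm x.
  apply: dense_nrm_le => [|s]; first exact: nrm_ge0.
  have -> : inner (lincomb v s) (T x) = inner (lincomb w s) x.
    by rewrite !inner_lincombl; apply: eq_bigr => p _; rewrite hT.
  by rewrite (le_trans (Re_inner_le _ _)) // mulrC ler_wpM2l ?nrm_ge0.
have T_sym x y : inner (T x) y = inner x (T y).
  (* The factors 1, -1, i and -i turn the equality into inequalities, to which the density argument
     applies in the variable [x]. *)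
  suff Re_ge0 (z : R[i]) : 0 <= complex.Re (z * (inner (T x) y - inner x (T y))).
    have := Re_ge0 1; have := Re_ge0 (- 1); have := Re_ge0 'i%C; have := Re_ge0 (- 'i%C).
    case: (inner (T x) y) (inner x (T y)) => a b [a' b'] /= h1 h2 h3 h4.
    by apply/eqP; rewrite eq_complex /=; apply/andP; split; apply/eqP; lra.
  apply: (@dense_ge0 (fun x => complex.Re (z * (inner (T x) y - inner x (T y))))) => [{}x|s].
    exists (2 * nrm (z^* *: y)) => x' _.
    have Re_sub u : z * (inner (T u) y - inner u (T y)) =
        inner (T u) (z^* *: y) - inner u (T (z^* *: y)).
      by rewrite [T (_ *: _)]linearZ !innerZr conjCK mulrBr.
    rewrite !Re_sub; set y' := z^* *: y.
    have h1 := Re_inner_le (T (x' - x)) y'.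
    have h2 := Re_inner_le (x - x') (T y').
    have h3 : nrm (T (x' - x)) * nrm y' <= nrm (x - x') * nrm y'.
      by rewrite ler_wpM2r ?nrm_ge0 // nrm_distC.
    have h4 : nrm (x - x') * nrm (T y') <= nrm (x - x') * nrm y'.
      by rewrite ler_wpM2l ?nrm_ge0.
    move: h1 h2; rewrite {1}[T (_ - _)]raddfB !innerDl !innerNl !ReD !ReN; nra.
  rewrite (_ : inner _ _ - _ = 0) ?mulr0 //; apply/eqP; rewrite subr_eq0; apply/eqP.
  rewrite T_comb !inner_lincombl; apply: eq_bigr => p _.
  by rewrite hT.
have Im_T x : complex.Im (inner (T x) x) = 0.
  have := innerC (T x) x; rewrite -T_sym.
  by case: (inner (T x) x) => a b [] /=; lra.
(* Used for [S = T] and for [S = idfun \- T], which give the two operator inequalities. *)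
have Re_cont (S : {linear K -> K}) (c : R) : 0 <= c -> (forall x, nrm (S x) <= c * nrm x) ->
    (forall s, 0 <= complex.Re (inner (S (lincomb v s)) (lincomb v s))) ->
    forall x, 0 <= complex.Re (inner (S x) x).
  move=> c0 Sc S_ge0; apply: (@dense_ge0 (fun x => complex.Re (inner (S x) x))) => // x.
  exists (c * (nrm x + 1 + nrm x)) => y xy1.
  have h1 : nrm y <= nrm x + 1.
    by rewrite -[y](addrNK x) addrC (le_trans (nrmD _ _)) // nrm_distC lerD2l.
  have h2 : complex.Re (inner (S (y - x)) y) <= c * nrm (x - y) * (nrm x + 1).
    rewrite (le_trans (Re_inner_le _ _)) // ler_pM ?nrm_ge0 //.
    by rewrite nrm_distC Sc.
  have h3 : complex.Re (inner (S x) (y - x)) <= c * nrm x * nrm (x - y).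
    rewrite (le_trans (Re_inner_le _ _)) // [nrm (x - y)]nrm_distC.
    by rewrite ler_wpM2r ?nrm_ge0.
  move: h2 h3; rewrite {1}[S (_ - _)]raddfB innerDl innerNl innerDr innerNr !ReD !ReN; lra.
exists T; split => //.
- by apply: (@bounded_linear_nrm_continuous _ _ _ _ 1) => x; rewrite mul1r.
- move=> x; rewrite /= subr0; apply: complex_ge0 => //.
  apply: (@Re_cont T 1) => [//|{}x|s]; first by rewrite mul1r.
  by rewrite T_comb innerC inner_w -kernel_formC; have := form_ge0 s; rewrite lecE => /andP[].
- move=> x; apply: complex_ge0.
    by rewrite innerDl innerNl inner_self raddfB /= Im_T subr0.
  apply: (@Re_cont (idfun \- T) 2) => [//|{}x|s].
    by rewrite /= (le_trans (nrmD _ _)) // nrmN; have := T_le x; lra.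
  rewrite /= innerDl innerNl T_comb ReD ReN [inner (lincomb w s) _]innerC inner_w -kernel_formC.
  by have := form_le s; rewrite lecE subr_ge0 => /andP[].
- move=> g h; rewrite T_v innerC hw.
  have := kernel_formC [:: (1, h)] [:: (1, g)].
  by rewrite /kernel_form !big_seq1 rmorph1 !mul1r.
Qed.

End DominatedKernel.

(** * Positive semidefinite matrices are Gram matrices *)

(** Diagonalise M = P^* diag(d) P with P unitary. Each eigenvalue is the quadratic form at a
    conjugated row of P, hence nonnegative, and Y = sqrt(d) P works. *)
Lemma psd_factorization (R : realType) (U : finType) (M : U -> U -> R[i]) :
  (forall z : U -> R[i], 0 <= \sum_u \sum_v (z u)^* * z v * M u v) ->
  exists Y : U -> U -> R[i], forall u v, M u v = \sum_w (Y w u)^* * Y w v.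
Proof.
move=> M_ge0.
have M_herm u v : M u v = (M v u)^*.
  suff /kernel_formC h s : 0 <= kernel_form (fun u v => M v u) s s.
    have := h [:: (1, u)] [:: (1, v)].
    by rewrite /kernel_form !big_seq1 rmorph1 !mul1r.
  have := M_ge0 (fun u => \sum_(p <- s | p.2 == u) p.1).
  congr (0 <= _).
  (* A list may repeat an index; its coefficients are added up to give a vector indexed by [U]. *)
  have collapse (f : R[i] -> R[i]) (F : U -> R[i]) : {morph f : x y / x + y} -> f 0 = 0 ->
      \sum_w f (\sum_(p <- s | p.2 == w) p.1) * F w = \sum_(p <- s) f p.1 * F p.2.
    move=> fD f0; under eq_bigr do rewrite (big_morph f fD f0) mulr_suml big_mkcond.
    rewrite exchange_big; apply: eq_bigr => p _.
    by rewrite -big_mkcond (big_pred1 p.2) // => w; rewrite eq_sym.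
  under eq_bigr do under eq_bigr do rewrite -mulrA.
  under eq_bigr do rewrite -mulr_sumr.
  rewrite (collapse _ _ (rmorphD _) (rmorph0 _)) /kernel_form exchange_big.
  apply: eq_bigr => p _; rewrite (collapse id) // mulr_sumr.
  by apply: eq_bigr => q _; rewrite mulrA [_ * q.1]mulrC.
pose A : 'M[R[i]]_#|U| := \matrix_(i, j) M (enum_val i) (enum_val j).
have A_herm : A \is hermsymmx.
  apply/is_hermitianmxP; rewrite expr0 scale1r.
  by apply/matrixP => i j; rewrite !mxE M_herm.
have /hermitian_normalmx/orthomx_spectralP := A_herm.
set P := spectralmx A; set d := spectral_diag A => AE.
have P_unit : P \is unitarymx := spectral_unitarymx A.
have dE i : d 0 i = \sum_u \sum_v P i u * (P i v)^* * A u v.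
  have diagE : diag_mx d = P *m A *m invmx P.
    rewrite AE !mulmxA mulmxV ?unitarymx_unit // mul1mx -mulmxA.
    by rewrite mulmxV ?unitarymx_unit // mulmx1.
  have -> : d 0 i = diag_mx d i i by rewrite mxE eqxx.
  rewrite diagE invmx_unitary // mxE exchange_big; apply: eq_bigr => v _.
  rewrite !mxE mulr_suml; apply: eq_bigr => u _.
  by rewrite -mulrA [_ * (P i v)^*]mulrC mulrA.
have d_ge0 i : 0 <= d 0 i.
  have := M_ge0 (fun u => (P i (enum_rank u))^*); rewrite dE; congr (0 <= _).
  rewrite [RHS](reindex _ (onW_bij _ (enum_rank_bij U))); apply: eq_bigr => u _.
  rewrite [RHS](reindex _ (onW_bij _ (enum_rank_bij U))); apply: eq_bigr => v _.
  by rewrite conjCK mxE !enum_rankK.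
exists (fun w u => sqrtC (d 0 (enum_rank w)) * P (enum_rank w) (enum_rank u)) => u v.
have -> : M u v = A (enum_rank u) (enum_rank v) by rewrite mxE !enum_rankK.
rewrite AE invmx_unitary // mul_mx_diag mxE (reindex _ (onW_bij _ (enum_rank_bij U))).
apply: eq_bigr => w _; rewrite !mxE rmorphM /=.
have -> : (sqrtC (d 0 (enum_rank w)))^* = sqrtC (d 0 (enum_rank w)).
  by rewrite conj_Creal // ger0_real // sqrtC_ge0.
by rewrite mulrACA -expr2 sqrtCK mulrCA mulrA.
Qed.

(** * Positions, folding and invariance *)

Section Positions.
Variable k : nat.
Notation m := (k.+1)./2.

(* [left_pos s] and its mirror image are the positions of the two factors of
   [folded_arg a s]; they coincide at the middle position of an odd [k], where
   [s = 0]. *)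
Definition left_pos (s : 'I_m) : 'I_k := widen_ord (half_succ_le k) (rev_ord s).

Lemma left_pos_inj : injective left_pos.
Proof. by move=> s t /(congr1 val)/= h; apply/rev_ord_inj/val_inj. Qed.

Definition depth (l : 'I_k) : option 'I_m := [pick s | left_pos s == l].

Lemma depth_left_pos s : depth (left_pos s) = Some s.
Proof.
rewrite /depth; case: pickP => [t /eqP/left_pos_inj -> //|/(_ s)].
by rewrite eqxx.
Qed.

Lemma depth_ge (l : 'I_k) : (m <= l)%N -> depth l = None.
Proof.
rewrite /depth; case: pickP => // s /eqP <- /=; rewrite leqNgt.
by have := ltn_ord s; lia.
Qed.

(** A position is strictly left of the middle, strictly right of it, or the middle one of an odd
    [k]; only the last has both depths defined. *)
Variant position_spec (l : 'I_k) : option 'I_m -> option 'I_m -> Prop :=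
| LeftPosition s of l = left_pos s & (l < k./2)%N & (m <= rev_ord l)%N :
    position_spec l (Some s) None
| RightPosition s of l = rev_ord (left_pos s) & (m <= l)%N
    & (left_pos s < k./2)%N : position_spec l None (Some s)
| MiddlePosition s of l = left_pos s & rev_ord l = l & s = 0 :> nat & odd k :
    position_spec l (Some s) (Some s).

Lemma positionP l : position_spec l (depth l) (depth (rev_ord l)).
Proof.
have left_posE (l' : 'I_k) : (l' < m)%N -> exists s, l' = left_pos s.
  move=> lm; exists (rev_ord (Ordinal lm)); apply: val_inj => /=; lia.
have lk := ltn_ord l; have [lm|ml] := ltnP l m; last first.
  have [|s sE] := left_posE (rev_ord l); first by rewrite /=; lia.
  rewrite sE depth_left_pos depth_ge //; constructor => //.
    by rewrite -sE rev_ordK.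
  by rewrite -sE /=; lia.
have [s sE] := left_posE l lm.
have [rm|mr] := ltnP (rev_ord l) m; last first.
  rewrite (depth_ge mr) {2}sE depth_left_pos; constructor => //.
  by move: mr => /=; lia.
have rE : rev_ord l = l by apply: val_inj; move: rm => /=; lia.
rewrite rE {2 3}sE depth_left_pos; constructor => //.
  by have := congr1 val sE; have := congr1 val rE; move: rm (ltn_ord s) => /=; lia.
by have := congr1 val rE; rewrite /=; lia.
Qed.

End Positions.
Arguments depth {k}.
Arguments left_pos {k}.

Section Merge.
Variables (A : starRingType) (k : nat).
Notation m := (k.+1)./2.
Implicit Types (b c : 'I_m -> A).

Lemma star1 : star (1 : A) = 1.
Proof. by rewrite -[LHS]mulr1 -{2}[1]starK -starM mulr1 starK. Qed.

(* The tuple (c_m^*, ..., c_1^*, b_1, ..., b_m), whose two middle entries are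
   multiplied together when [k] is odd. *)
Definition merge c b (l : 'I_k) : A :=
  (if depth l is Some s then star (c s) else 1) *
  (if depth (rev_ord l) is Some s then b s else 1).

End Merge.

(** Off the middle the two factors sit at mirror positions; in the middle [merge] has already
    multiplied them. In particular, folding [merge (fun=> 1) b] gives back [b]. *)
Lemma folded_arg_merge (R : realType) (A : cstarAlgType R) (k : nat)
    (b c : 'I_(k.+1)./2 -> A) s :
  folded_arg (merge c b) s = star (c s) * b s.
Proof.
rewrite /folded_arg -/(left_pos s) /merge rev_ordK depth_left_pos.
case: (positionP (left_pos s)) (depth_left_pos s) => [t _ _ mr _|//|t _ -> _ _ [->]].
  rewrite ifN ?mulr1 ?mul1r //; apply/eqP => /(congr1 val) /= e.
  by move: mr (ltn_ord s) => /=; lia.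
by rewrite eqxx.
Qed.

Section Multilinear.
Variables (F : nzRingType) (A : lmodType F) (k : nat) (f : ('I_k -> A) -> F).
Hypothesis f_lin : multilinear f.

Lemma multilinear_eq0 (a : 'I_k -> A) l : a l = 0 -> f a = 0.
Proof.
move=> al; have := f_lin l a 1 0 0; rewrite scale1r addr0 mul1r.
have -> : ([eta a with l |-> 0] : _ -> _) = a by apply/funext => x /=; case: eqP => // ->.
by move/eqP; rewrite -subr_eq0 opprD addNKr oppr_eq0 => /eqP.
Qed.

Lemma multilinear_sum (I : Type) (r : seq I) (a : 'I_k -> A) l (d : I -> A) :
  f [eta a with l |-> \sum_(c <- r) d c] = \sum_(c <- r) f [eta a with l |-> d c].
Proof.
elim: r => [|c r IH].
  by rewrite !big_nil; apply: (@multilinear_eq0 _ l); rewrite /= eqxx.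
by rewrite !big_cons -IH -{1}[d c]scale1r f_lin mul1r.
Qed.

(** A path through a zero entry contributes 0 by multilinearity. This is how single values of [psi]
    are recovered from matrix-valued maps. *)
Lemma path_sum_single (U : finType) (X : 'I_k -> U -> U -> A) (u v : U)
    (r0 : {ffun 'I_k.+1 -> U}) :
  r0 ord0 = u -> r0 ord_max = v ->
  (forall r : {ffun 'I_k.+1 -> U}, r ord0 = u -> r ord_max = v ->
    (forall l, X l (r (widen_ord (leqnSn k) l)) (r (lift ord0 l)) != 0) ->
    r = r0) ->
  \sum_(r : {ffun 'I_k.+1 -> U} | (r ord0 == u) && (r ord_max == v))
     f (fun l => X l (r (widen_ord (leqnSn k) l)) (r (lift ord0 l))) =
  f (fun l => X l (r0 (widen_ord (leqnSn k) l)) (r0 (lift ord0 l))).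
Proof.
move=> r0u r0v r0_uniq; rewrite (bigD1 r0) /= ?r0u ?r0v ?eqxx //.
rewrite big1 ?addr0 // => r /andP[/andP[/eqP ru /eqP rv] /eqP rr0].
have [l /eqP] : exists l, X l (r (widen_ord (leqnSn k) l)) (r (lift ord0 l)) == 0.
  apply: contrapT => /forallNP h; apply: rr0; apply: r0_uniq => // l.
  exact/negP.
exact: multilinear_eq0.
Qed.

End Multilinear.

Section ScalarInvariance.
Variables (R : realType) (A : cstarAlgType R) (n k : nat).
Hypothesis k_gt0 : (0 < k)%N.
Variable psi : 'I_n -> 'I_n -> ('I_k -> A) -> R[i].
Hypothesis psi_icp : icp_block psi.

(* Diagonal matrices alone only reach the diagonal entries of a block map; the
   last argument is spread over all entries to reach the others. *)
Definition spread (b : bool) (a : A) : 'M[A]_n :=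
  \matrix_(i, j) (if b || (i == j) then a else 0).

Lemma spread_mulr b a a' : spread b a * spread false a' = spread b (a * a').
Proof.
apply/matrixP => i j; rewrite !mxE (bigD1 j) //= !mxE eqxx big1 ?addr0 => [|c cj].
  by case: ifP; rewrite ?mul0r.
by rewrite !mxE (negPf cj) mulr0.
Qed.

Lemma spread_mull b a a' : spread false a' * spread b a = spread b (a' * a).
Proof.
apply/matrixP => i j; rewrite !mxE (bigD1 i) //= !mxE eqxx big1 ?addr0 => [|c ci].
  by case: ifP; rewrite ?mulr0.
by rewrite !mxE eq_sym (negPf ci) mul0r.
Qed.

(** All matrices but the last are diagonal, so a contributing path stays at [i] until its last
    step. *)
Lemma block_spread (a : 'I_k -> A) i j :
  block psi (fun l => spread (l.+1 == k) (a l)) i j = psi i j a.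
Proof.
rewrite mxE.
rewrite (path_sum_single (icp_multilinear psi_icp i j)
  (X := fun l u v => spread (l.+1 == k) (a l) u v)
  (r0 := [ffun x : 'I_k.+1 => if x == k :> nat then j else i])).
- congr (psi _ _ _); apply/funext => l; rewrite mxE !ffunE /= /bump /= add1n.
  by rewrite (ltn_eqF (ltn_ord l)); case: (l.+1 == k) => //=; rewrite eqxx.
- by rewrite ffunE /= eq_sym gtn_eqF.
- by rewrite ffunE /= eqxx.
move=> r ri rj r_neq0; apply/ffunP => x; rewrite ffunE.
have [xk|xk] := eqVneq (x : nat) k; first by rewrite -rj; congr (r _); apply: val_inj.
have {xk} : (x < k)%N by have := ltn_ord x; lia.
case: x => x xk1 /= xk.
elim: x xk1 xk => [|x IH] xk1 xk; first by rewrite -ri; congr (r _); apply: val_inj.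
have xk' : (x < k)%N by lia.
rewrite -(IH (ltnW xk1) xk').
have := r_neq0 (Ordinal xk'); rewrite mxE /= ltn_eqF //=.
case: ifP => [/eqP e _|_ /eqP //].
transitivity (r (lift ord0 (Ordinal xk'))); first by congr (r _); apply: val_inj.
by rewrite -e; congr (r _); apply: val_inj.
Qed.

Lemma icp_scalar_invariant (x y : 'I_k -> A) i j :
  psi i j (fun l => if (l < k./2)%N then x l * y l else x l) =
  psi i j (fun l => if (rev_ord l < k./2)%N then y (rev_ord l) * x l else x l).
Proof.
have := congr1 (fun M : 'M[R[i]]_n => M i j) (icp_invariant psi_icp
  (fun l => spread (l.+1 == k) (x l)) (fun l => spread false (y l))).
rewrite -!block_spread; congr (_ = _); congr (block _ _ _ _).
  by apply/funext => l; case: ifP; rewrite ?spread_mulr.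
by apply/funext => l; case: ifP; rewrite ?spread_mull.
Qed.

(** Invariance is applied to [a] with its left half replaced by 1, the multipliers being [a] itself:
    each left entry moves onto its mirror image. *)
Lemma icp_fold (a : 'I_k -> A) i j :
  psi i j a = psi i j (merge (fun=> 1) (folded_arg a)).
Proof.
have := icp_scalar_invariant (fun l => if (l < k./2)%N then 1 else a l) a i j.
congr (_ = _); congr (psi _ _ _).
  by apply/funext => l; case: (_ < _)%N; rewrite ?mul1r.
apply/funext => l; rewrite /merge /folded_arg.
case: positionP => [s lE lk mr|s lE ml sk|s lE rE s0 kodd].
- rewrite lk star1 mul1r ifN //; rewrite -leqNgt; lia.
- rewrite -/(left_pos s) lE !rev_ordK sk -lE ifN; last by rewrite -leqNgt; lia.
  rewrite mul1r ifN //; apply/eqP => /(congr1 val) /= e.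
  move: ml e; rewrite lE; have := ltn_ord s; lia.
- have lk : (l < k./2)%N = false by rewrite lE /= s0; lia.
  by rewrite -/(left_pos s) -lE rE eqxx star1 mul1r lk.
Qed.

End ScalarInvariance.

(** * Products of commuting representations *)

(** [adjoint] is obtained by choice, so an adjoint is exhibited first; pairing with 1 then
    determines the value. *)
Lemma adjoint_functional (R : realType) (K : hilbertType R)
    (V : {linear R[i]^o -> K}) (y : K) :
  adjoint V y = inner y (V 1).
Proof.
have V_adj : is_adjoint V (fun y => inner y (V 1) : R[i]^o).
  move=> x z; rewrite -[x]mulr1 -[x * 1]/(x *: (1 : R[i]^o)) linearZ innerZl.
  rewrite /= [inner (V 1) z]innerC; congr (_ * _).
  by rewrite -[x *: 1]/(x * 1) mulr1.
have /(_ 1 y) : is_adjoint V (adjoint V) := xgetPex _ (ex_intro _ _ V_adj).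
rewrite innerC => /(congr1 Num.conj); rewrite conjCK => ->.
by rewrite /inner /= /cinner mul1r conjCK.
Qed.

Section Representations.
Variables (R : realType) (A : cstarAlgType R) (k : nat) (K : hilbertType R).
Notation m := (k.+1)./2.
Variable pi : 'I_m -> A -> {linear K -> K}.
Hypothesis pi_rep : forall s, star_rep (pi s).
Hypothesis pi_comm : forall s t, s != t ->
  forall a b x, pi s a (pi t b x) = pi t b (pi s a x).
Implicit Types (r : seq 'I_m) (b c : 'I_m -> A) (x y : K).

(** Inductions on the product run over lists of indices; [rep_prod] is the case of the full
    enumeration. *)
Definition partial_prod r b : K -> K :=
  \big[comp/idfun]_(s <- r) (pi s (b s) : K -> K).

Lemma partial_prod_cons s r b x :
  partial_prod (s :: r) b x = pi s (b s) (partial_prod r b x).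
Proof. by rewrite /partial_prod big_cons. Qed.

Lemma partial_prod_comm s r a b x : s \notin r ->
  pi s a (partial_prod r b x) = partial_prod r b (pi s a x).
Proof.
elim: r x => [|t r IH] x; first by rewrite /partial_prod !big_nil.
rewrite inE negb_or => /andP[st sr].
by rewrite !partial_prod_cons pi_comm // IH.
Qed.

(** Each starred factor crosses the inner product as an adjoint, and commutes past the remaining
    factors because their indices differ from its own. *)
Lemma inner_partial_prod r b c x y : uniq r ->
  inner (partial_prod r (fun s => star (c s) * b s) x) y =
  inner (partial_prod r b x) (partial_prod r c y).
Proof.
elim: r x y => [|s r IH] x y /=; first by rewrite /partial_prod !big_nil.
case/andP=> sr r_uniq; rewrite !partial_prod_cons (star_repM (pi_rep s)).
rewrite (star_rep_star (pi_rep s)) starK !partial_prod_comm //.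
by rewrite IH // !partial_prod_comm.
Qed.

Lemma partial_prod_mul r s a b x : uniq r ->
  partial_prod r (fun t => if t == s then a * b t else b t) x =
  if s \in r then pi s a (partial_prod r b x) else partial_prod r b x.
Proof.
elim: r x => [|t r IH] x /=; first by rewrite /partial_prod !big_nil.
case/andP=> tr r_uniq; rewrite !partial_prod_cons IH // inE [s == t]eq_sym.
have [ts|ts] /= := eqVneq t s; first by rewrite -ts (negPf tr) (star_repM (pi_rep t)).
by case: ifP => // _; rewrite pi_comm.
Qed.

Lemma partial_prodZD r b a x y :
  partial_prod r b (a *: x + y) = a *: partial_prod r b x + partial_prod r b y.
Proof.
elim: r => [|s r IH]; first by rewrite /partial_prod !big_nil.
by rewrite !partial_prod_cons IH linearP.
Qed.

Lemma rep_prodE b : rep_prod pi b = partial_prod (index_enum _) b.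
Proof. by []. Qed.

Lemma rep_prod_is_linear b : linear (rep_prod pi b).
Proof. by move=> a x y; rewrite rep_prodE partial_prodZD. Qed.

Lemma inner_rep_prod b c x y :
  inner (rep_prod pi (fun s => star (c s) * b s) x) y =
  inner (rep_prod pi b x) (rep_prod pi c y).
Proof. by rewrite !rep_prodE inner_partial_prod ?index_enum_uniq. Qed.

Lemma rep_prod_mul s a b x :
  rep_prod pi (fun t => if t == s then a * b t else b t) x =
  pi s a (rep_prod pi b x).
Proof. by rewrite !rep_prodE partial_prod_mul ?index_enum_uniq ?mem_index_enum. Qed.

Lemma rep_prod_commutant (T : K -> K) b x :
  in_commutant pi T -> T (rep_prod pi b x) = rep_prod pi b (T x).
Proof.
move=> T_comm; rewrite !rep_prodE; elim: index_enum x => [|s r IH] x.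
  by rewrite /partial_prod !big_nil.
by rewrite !partial_prod_cons -T_comm IH.
Qed.

Lemma stinespring_form_merge n (V : 'I_n -> {linear R[i]^o -> K}) (T : K -> K)
    i j b c : in_commutant pi T ->
  stinespring_form pi V T i j (merge c b) =
  inner (T (rep_prod pi b (V j 1))) (rep_prod pi c (V i 1)).
Proof.
move=> T_comm; rewrite /stinespring_form adjoint_functional.
have -> : folded_arg (merge c b) = fun s => star (c s) * b s.
  by apply/funext => s; rewrite folded_arg_merge.
by rewrite !rep_prod_commutant // inner_rep_prod.
Qed.

Lemma stinespring_form_fold n (V : 'I_n -> {linear R[i]^o -> K}) (T : K -> K) i j a :
  stinespring_form pi V T i j (merge (fun=> 1) (folded_arg a)) =
  stinespring_form pi V T i j a.
Proof.
rewrite /stinespring_form (_ : folded_arg (merge _ _) = folded_arg a) //.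
by apply/funext => s; rewrite folded_arg_merge star1 mul1r.
Qed.

End Representations.

(** * Amplified block maps as sums over paths *)

Section PathMatrix.
Variables (R : realType) (A : starRingType) (n k : nat).
Variable psi : 'I_n -> 'I_n -> ('I_k -> A) -> R[i].

(** Matrices of matrices are flattened to matrices indexed by pairs: the paths of the amplification
    and those of the block map become one path of pairs. *)
Definition path_mx (t : nat) (X : 'I_k -> 'I_t * 'I_n -> 'I_t * 'I_n -> A)
    (u v : 'I_t * 'I_n) : R[i] :=
  \sum_(r : {ffun 'I_k.+1 -> 'I_t * 'I_n} | (r ord0 == u) && (r ord_max == v))
    psi u.2 v.2 (fun l => X l (r (widen_ord (leqnSn k) l)) (r (lift ord0 l))).

Definition gram (S : starRingType) (U : finType) (Y : U -> U -> S) (u v : U) : S :=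
  \sum_w star (Y w u) * Y w v.

Definition path_positive (t : nat) (X : 'I_k -> 'I_t * 'I_n -> 'I_t * 'I_n -> A) :=
  (forall l u v, X l u v = star (X (rev_ord l) v u)) /\
  (forall l : 'I_k, k = l.*2.+1 -> exists Y, X l = gram Y).

Lemma amplification_blockE t (X : 'I_k -> 'M['M[A]_n]_t) p q i j :
  amplification (block psi) X p q i j =
  path_mx (fun l u v => X l u.1 v.1 u.2 v.2) (p, i) (q, j).
Proof.
rewrite mxE summxE; under eq_bigr do rewrite mxE.
rewrite pair_big_dep /=.
pose unpair (r : {ffun 'I_k.+1 -> 'I_t * 'I_n}) :=
  ([ffun x => (r x).1] : {ffun 'I_k.+1 -> 'I_t},
   [ffun x => (r x).2] : {ffun 'I_k.+1 -> 'I_n}).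
rewrite (reindex unpair) /=; last first.
  exists (fun p : {ffun 'I_k.+1 -> 'I_t} * {ffun 'I_k.+1 -> 'I_n} =>
    [ffun x => (p.1 x, p.2 x)]) => [r _|[r s] _].
    by apply/ffunP => x; rewrite !ffunE; case: (r x).
  by congr (_, _); apply/ffunP => x; rewrite !ffunE.
apply: eq_big => [r|r _].
  rewrite !ffunE; case: (r ord0) => a b; case: (r ord_max) => c d /=.
  by rewrite !xpair_eqE andbACA.
by congr (psi _ _ _); apply/funext => l; rewrite !ffunE.
Qed.

Lemma star_pos_mxE (S : starRingType) t (X : 'M['M[S]_n]_t) :
  star_pos X <-> exists Y, forall u v, X u.1 v.1 u.2 v.2 = gram Y u v.
Proof.
have mulE (Y : 'M['M[S]_n]_t) p q i j : (star Y * Y) p q i j =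
    gram (fun u v => Y u.1 v.1 u.2 v.2) (p, i) (q, j).
  rewrite mxE summxE /gram; under eq_bigr do rewrite mxE.
  by rewrite pair_big; apply: eq_bigr => -[a b] _; rewrite !mxE.
split=> [[Y ->]|[Y XE]].
  by exists (fun u v => Y u.1 v.1 u.2 v.2) => -[p i] [q j]; rewrite mulE.
exists (\matrix_(p, q) \matrix_(i, j) Y (p, i) (q, j)).
apply/matrixP => p q; apply/matrixP => i j; rewrite mulE.
have /= -> := XE (p, i) (q, j); apply: eq_bigr => -[a b] _.
by rewrite !mxE.
Qed.

Lemma completely_positive_path t (X : 'I_k -> 'I_t * 'I_n -> 'I_t * 'I_n -> A) :
  completely_positive (block psi) -> path_positive X ->
  exists Y, forall u v, path_mx X u v = gram Y u v.
Proof.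
move=> cp [X_star X_mid].
pose X' l := \matrix_(p, q) \matrix_(i, j) X l (p, i) (q, j).
have [|l kl|Y YE] := (star_pos_mxE (amplification (block psi) X')).1 (cp t X' _ _).
- by move=> l; do 2!apply/matrixP => ? ?; rewrite !mxE X_star.
- have [Y XE] := X_mid l kl; apply/star_pos_mxE; exists Y => -[p i] [q j].
  by rewrite !mxE XE.
exists Y => -[p i] [q j]; rewrite -YE amplification_blockE.
congr path_mx; apply/funext => l; apply/funext => -[a b]; apply/funext => -[c d].
by rewrite !mxE.
Qed.

Lemma path_completely_positive :
  (forall t (X : 'I_k -> 'I_t * 'I_n -> 'I_t * 'I_n -> A), path_positive X ->
    forall z : 'I_t * 'I_n -> R[i],
      0 <= \sum_u \sum_v (z u)^* * z v * path_mx X u v) ->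
  completely_positive (block psi).
Proof.
move=> X_ge0 t X X_star X_mid; apply/star_pos_mxE.
have [|Y YE] := psd_factorization (X_ge0 t (fun l u v => X l u.1 v.1 u.2 v.2) _).
  split=> [l u v|l kl]; first by rewrite X_star !mxE.
  have /star_pos_mxE[Y YE] := X_mid l kl.
  by exists Y; apply/funext => u; apply/funext => v; rewrite YE.
exists Y => -[p i] [q j]; rewrite amplification_blockE; exact: YE.
Qed.

End PathMatrix.

(** * The kernel of a completely positive block map *)

Section MergeKernel.
Variables (R : realType) (A : cstarAlgType R) (n k t : nat).
Notation m := (k.+1)./2.
Notation U := ('I_t * 'I_n)%type.
Variables (b : U -> 'I_m -> A) (u0 : U).

(* The matrices [X l = (R (rev l))^* R l] with [R = ray_mx] are diagonal except
   next to the middle, where every contributing path goes through [u0]; hence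
   only one path from [u] to [v] contributes to the entry (u, v). *)
Definition ray_mx (l : 'I_k) (x y : U) : A :=
  if depth (rev_ord l) is Some s then
    if if s == 0 :> nat then x == u0 else x == y then b y s else 0
  else if x == y then 1 else 0.

Definition ray_gram (l : 'I_k) (x y : U) : A :=
  \sum_w star (ray_mx (rev_ord l) w x) * ray_mx l w y.

Lemma ray_gram_positive : path_positive ray_gram.
Proof.
split=> [l u v|l kl].
  rewrite /ray_gram (big_morph _ (@starD _) (@star0 A)) rev_ordK.
  by apply: eq_bigr => w _; rewrite starM starK.
have rE : rev_ord l = l by apply: val_inj => /=; lia.
by exists (ray_mx l); rewrite /ray_gram rE.
Qed.

Lemma ray_gramE l x y : ray_gram l x y =
  match depth l, depth (rev_ord l) with
  | Some s, None =>
      if if s == 0 :> nat then y == u0 else x == y then star (b x s) else 0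
  | None, Some s => if if s == 0 :> nat then x == u0 else x == y then b y s else 0
  | Some s, Some _ => star (b x s) * b y s
  | None, None => 0
  end.
Proof.
rewrite /ray_gram /ray_mx rev_ordK.
case: positionP => [s _ _ _|s _ _ _|s _ _ s0 _].
- rewrite (bigD1 y) //= eqxx mulr1 big1 ?addr0 => [|w /negPf ->]; last by rewrite mulr0.
  by rewrite [y == x]eq_sym; case: ifP => _; rewrite ?star0.
- rewrite (bigD1 x) //= eqxx star1 mul1r big1 ?addr0 // => w /negPf ->.
  by rewrite star0 mul0r.
rewrite s0 eqxx (bigD1 u0) //= eqxx big1 ?addr0 // => w /negPf ->.
by rewrite mulr0.
Qed.

Lemma ray_gram_path (f : ('I_k -> A) -> R[i]) u v : (0 < k)%N -> multilinear f ->
  \sum_(r : {ffun 'I_k.+1 -> U} | (r ord0 == u) && (r ord_max == v))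
     f (fun l => ray_gram l (r (widen_ord (leqnSn k) l)) (r (lift ord0 l))) =
  f (merge (b u) (b v)).
Proof.
move=> k0 f_lin.
(* The path stays at [u], then at [v]; the value [u0] occurs only at the midpoint, which exists for
   even [k]. *)
pose r0 := [ffun x : 'I_k.+1 =>
  if (x < m)%N then u else if (k - m < x)%N then v else u0].
rewrite (path_sum_single f_lin (r0 := r0)); first 1 last.
- by rewrite ffunE /=; case: ifP => // /negP[]; lia.
- by rewrite ffunE /=; case: ifP => [|_]; [lia|case: ifP => // /negP[]; lia].
- move=> r ru rv r_neq0; pose g x := r (inord x).
  have step (l : 'I_k) : ray_gram l (g l) (g l.+1) != 0.
    have := r_neq0 l; rewrite /g.
    have -> : widen_ord (leqnSn k) l = inord l.
      by apply: val_inj; rewrite /= inordK // ltnW // ltnS.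
    by have -> : lift ord0 l = inord l.+1 by apply: val_inj; rewrite /= inordK // ltnS.
  have g_left x : (x < m)%N -> g x = u.
    elim: x => [_|x IH xm].
      by rewrite -ru; congr (r _); apply: val_inj; rewrite /= inordK.
    have xk : (x < k)%N by lia.
    rewrite -IH; last by lia.
    have := step (Ordinal xk); rewrite ray_gramE.
    case: positionP => [s lE _ _|s _ /= ml|s _ /(congr1 val) /= lE]; try lia.
    have xE : x = (m - s.+1)%N := congr1 val lE.
    have -> : (s == 0 :> nat) = false by have := ltn_ord s; lia.
    by case: ifP => [/eqP ->|_ /eqP].
  have g_right x : (x < m)%N -> g (k - x)%N = v.
    elim: x => [_|x IH xm].
      by rewrite -rv; congr (r _); apply: val_inj; rewrite /= subn0 inordK.
    have xk : (k - x.+1 < k)%N by lia.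
    have {}IH := IH (ltnW xm).
    have := step (Ordinal xk); rewrite ray_gramE.
    case: positionP => [s lE /= lk|s lE _ _|s _ /(congr1 val) /= lE]; try lia.
    have xE : (k - x.+1 = k - (m - s.+1).+1)%N := congr1 val lE.
    have -> : (s == 0 :> nat) = false by have := ltn_ord s; lia.
    have -> : (k - x.+1).+1 = (k - x)%N by lia.
    by rewrite IH; case: ifP => [/eqP|_ /eqP].
  apply/ffunP => x; rewrite ffunE.
  have -> : r x = g x by rewrite /g inord_val.
  case: ifP => [/g_left //|/negP xm]; case: ifP => [xk|/negP xk].
    rewrite -[x : nat](@subKn _ k); last by rewrite -ltnS.
    by apply: g_right; have := ltn_ord x; lia.
  (* What remains is the midpoint of an even [k]: the step leading to it has depth 0, and its entry
     vanishes unless it ends at [u0]. *)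
  have mk : (m.-1 < k)%N by lia.
  have -> : (x : nat) = m.-1.+1 by lia.
  have := step (Ordinal mk); rewrite ray_gramE.
  case: positionP => [s lE _ _|s lE ml _|s _ rE _ _]; first last.
  - by have := congr1 val rE => /=; lia.
  - by have := ml; rewrite /=; lia.
  have -> : (s == 0 :> nat).
    by have : m.-1 = (m - s.+1)%N := congr1 val lE; have := ltn_ord s; lia.
  by case: ifP => [/eqP ->|_ /eqP].
congr f; apply/funext => l; rewrite ray_gramE /merge !ffunE /= /bump /= add1n.
rewrite -![uphalf k]/m.
case: positionP => [s lE lk mr|s lE ml sk|s lE rE s0 kodd].
- have lE' : l = (m - s.+1)%N :> nat := congr1 val lE; have sm := ltn_ord s.
  have {}mr : (m <= k - l.+1)%N := mr.
  rewrite (_ : (l < m)%N = true); last by lia.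
  rewrite mulr1; case: eqP => s0.
    rewrite (_ : (l.+1 < m)%N = false); last by lia.
    by rewrite (_ : (k - m < l.+1)%N = false) ?eqxx //; lia.
  by rewrite (_ : (l.+1 < m)%N = true) ?eqxx //; lia.
- have lE' : l = (k - (m - s.+1).+1)%N :> nat := congr1 val lE; have sm := ltn_ord s.
  rewrite (_ : (l < m)%N = false); last by lia.
  rewrite (_ : (l.+1 < m)%N = false); last by lia.
  rewrite (_ : (k - m < l.+1)%N = true); last by lia.
  rewrite mul1r; case: eqP => s0.
    by rewrite (_ : (k - m < l)%N = false) ?eqxx //; lia.
  by rewrite (_ : (k - m < l)%N = true) ?eqxx //; lia.
- have lE' : l = (m - s.+1)%N :> nat := congr1 val lE; have sm := ltn_ord s.
  rewrite (_ : (l < m)%N = true); last by lia.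
  rewrite (_ : (l.+1 < m)%N = false); last by lia.
  by rewrite (_ : (k - m < l.+1)%N = true) //; lia.
Qed.

Lemma merge_kernel_gram (psi : 'I_n -> 'I_n -> ('I_k -> A) -> R[i]) :
  (0 < k)%N -> icp_block psi ->
  exists Y : U -> U -> R[i], forall u v, psi u.2 v.2 (merge (b u) (b v)) = gram Y u v.
Proof.
move=> k0 psi_icp.
have [Y YE] := completely_positive_path (icp_completely_positive psi_icp) ray_gram_positive.
exists Y => u v; rewrite -YE /path_mx ray_gram_path //; exact: icp_multilinear.
Qed.
End MergeKernel.

(** * Cutting paths in the middle *)

Section JoinedPaths.
Variables (U : finType) (k : nat).
Notation m := (k.+1)./2.
Notation path := {ffun 'I_k.+1 -> U}.
Notation ray := {ffun 'I_m -> U}.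
Variable top : 'I_m.
Hypothesis topE : top = m.-1 :> nat.

(* A path is cut into two rays issued from its midpoint [c] when [k] is even.
   When [k] is odd there is no midpoint, and [c] is not used. *)
Definition join (c : U) (v' v : ray) : path := [ffun x : 'I_k.+1 =>
  if (x < m)%N then v' (insubd top (m.-1 - x)%N)
  else if (k - m < x)%N then v (insubd top (x - (k - m).+1)%N)
  else c].

Lemma val_insubd_lt x : (x < m)%N -> insubd top x = x :> nat.
Proof. by move=> xm; rewrite insubdK. Qed.

Lemma join_first c v' v : join c v' v ord0 = v' top.
Proof.
have tm := ltn_ord top; rewrite ffunE ifT; last by rewrite /=; lia.
by congr (v' _); apply: val_inj; rewrite /= -?[uphalf k]/m val_insubd_lt; lia.
Qed.

Lemma join_last c v' v : join c v' v ord_max = v top.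
Proof.
have := ltn_ord top => tm; rewrite ffunE ifF /=; last by apply/negP; lia.
rewrite ifT; last by lia.
by congr (v _); apply: val_inj; rewrite /= -?[uphalf k]/m val_insubd_lt; lia.
Qed.

(** Both rays are listed from the middle outwards, so that their index is the depth and [top] marks
    the ends of the path. *)
Definition left_ray (r : path) : ray := [ffun s : 'I_m => r (inord (m.-1 - s))].
Definition right_ray (r : path) : ray := [ffun s : 'I_m => r (inord ((k - m).+1 + s))].

Lemma left_rayK c v' v : left_ray (join c v' v) = v'.
Proof.
apply/ffunP => s; rewrite !ffunE; have sm := ltn_ord s.
rewrite inordK; last by lia.
rewrite ifT; last by lia.
by congr (v' _); apply: val_inj; rewrite /= -?[uphalf k]/m val_insubd_lt; lia.
Qed.

Lemma right_rayK c v' v : right_ray (join c v' v) = v.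
Proof.
apply/ffunP => s; rewrite !ffunE; have sm := ltn_ord s.
rewrite inordK; last by lia.
rewrite ifF; last by lia.
rewrite ifT; last by lia.
by congr (v _); apply: val_inj; rewrite /= -?[uphalf k]/m val_insubd_lt; lia.
Qed.

Lemma joinK c (r : path) : (odd k || (c == r (inord m))) ->
  join c (left_ray r) (right_ray r) = r.
Proof.
move=> hc; apply/ffunP => x; rewrite !ffunE.
have xk := ltn_ord x; have tm := ltn_ord top.
case: ifP => xm.
  by congr (r _); apply: val_inj; rewrite /= -?[uphalf k]/m inordK val_insubd_lt; lia.
case: ifP => xk'.
  by congr (r _); apply: val_inj; rewrite /= -?[uphalf k]/m inordK val_insubd_lt; lia.
case/orP: hc => [|/eqP->]; first by lia.
by congr (r _); apply: val_inj; rewrite /= -?[uphalf k]/m inordK; lia.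
Qed.

Lemma big_join_even (S : nmodType) (G : path -> S) : ~~ odd k ->
  \sum_r G r = \sum_c \sum_v' \sum_v G (join c v' v).
Proof.
move=> k_even; transitivity (\sum_c \sum_(p : ray * ray) G (join c p.1 p.2)); last first.
  by apply: eq_bigr => c _; rewrite pair_big.
rewrite pair_big /=.
rewrite (reindex (fun p : U * (ray * ray) => join p.1 p.2.1 p.2.2)) //=.
apply: onW_bij.
exists (fun r : path => (r (inord m), (left_ray r, right_ray r))) => [[c [v' v]]|r] /=.
  rewrite left_rayK right_rayK ffunE inordK; last by lia.
  by rewrite ifF ?ifF //; lia.
by rewrite joinK // eqxx orbT.
Qed.

(** [U] comes with no default element, so [v top] fills the slot of the midpoint. *)
Lemma big_join_odd (S : nmodType) (G : path -> S) : odd k ->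
  \sum_r G r = \sum_(v' : ray) \sum_(v : ray) G (join (v top) v' v).
Proof.
move=> k_odd; rewrite pair_big /=.
rewrite (reindex (fun p : ray * ray => join (p.2 top) p.1 p.2)) //=.
apply: onW_bij; exists (fun r => (left_ray r, right_ray r)) => [[v' v]|r] /=.
  by rewrite left_rayK right_rayK.
by rewrite joinK // k_odd.
Qed.

End JoinedPaths.

Section GramPositive.
Variables (R : realType) (A : cstarAlgType R) (n k t : nat).
Hypothesis k_gt0 : (0 < k)%N.
Notation m := (k.+1)./2.
Notation U := ('I_t * 'I_n)%type.
Notation ray := {ffun 'I_m -> U}.
Variable X : 'I_k -> U -> U -> A.
Hypothesis X_star : forall l u v, X l u v = star (X (rev_ord l) v u).
Variable top : 'I_m.
Hypothesis topE : top = m.-1 :> nat.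
Variable Y : U -> U -> A.
Hypothesis X_mid : forall l : 'I_k, k = l.*2.+1 -> X l = gram Y.

Definition ray_prev (c : U) (v : ray) (s : 'I_m) : U :=
  if s == 0 :> nat then c else v (insubd top s.-1).

(* For odd [k] the middle entry [X l = Y^* Y] supplies the missing midpoint: it
   is summed over like the midpoint of a path of even length. *)
Definition ray_factor (c : U) (v : ray) (s : 'I_m) : A :=
  (if odd k && (s == 0 :> nat) then Y else X (rev_ord (left_pos s)))
    (ray_prev c v s) (v s).

Definition step_entry (r : {ffun 'I_k.+1 -> U}) (l : 'I_k) : A :=
  X l (r (widen_ord (leqnSn k) l)) (r (lift ord0 l)).

(** Left of the middle the path runs against its ray, and [X_star] turns the entry into the star of
    its mirror entry. For odd [k] the middle entry is a Gram sum over a virtual midpoint, unrelated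
    to [c]. *)
Lemma step_entry_join c w (v' v : ray) l : odd k || (c == w) ->
  step_entry (join top c v' v) l =
  if rev_ord l == l then \sum_w' merge (ray_factor w' v') (ray_factor w' v) l
  else merge (ray_factor w v') (ray_factor w v) l.
Proof.
move=> hcw; rewrite /step_entry !ffunE /= /bump /= add1n -![uphalf k]/m /merge.
have c_w : ~~ odd k -> c = w by case/orP: hcw => [->|/eqP].
have topv (s : 'I_m) x (v0 : ray) : x = s :> nat -> v0 (insubd top x) = v0 s.
  by move=> ->; congr (v0 _); apply: val_inj; rewrite /= val_insubd_lt.
case: positionP => [s lE lk mr|s lE ml sk|s lE rE s0 kodd].
- have lE' : l = (m - s.+1)%N :> nat := congr1 val lE; have sm := ltn_ord s.
  have {}mr : (m <= k - l.+1)%N := mr.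
  rewrite (_ : (rev_ord l == l) = false); last by apply/negbTE/eqP => /(congr1 val) /=; lia.
  rewrite mulr1 /ray_factor /ray_prev -lE.
  rewrite (_ : (l < m)%N = true); last by lia.
  rewrite (topv s); last by lia.
  case: eqP => s0.
    rewrite (_ : odd k = false) /=; last by lia.
    rewrite (_ : (l.+1 < m)%N = false); last by lia.
    rewrite (_ : (k - m < l.+1)%N = false); last by lia.
    by rewrite X_star c_w //; lia.
  rewrite andbF (_ : (l.+1 < m)%N = true); last by lia.
  by rewrite X_star (_ : (m.-1 - l.+1 = s.-1)%N) //; lia.
- have lE' : l = (k - (m - s.+1).+1)%N :> nat := congr1 val lE; have sm := ltn_ord s.
  have {}ml : (m <= l)%N := ml.
  rewrite (_ : (rev_ord l == l) = false); last by apply/negbTE/eqP => /(congr1 val) /=; lia.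
  rewrite mul1r /ray_factor /ray_prev -lE.
  rewrite (_ : (l < m)%N = false); last by lia.
  rewrite (_ : (l.+1 < m)%N = false); last by lia.
  rewrite (_ : (k - m < l.+1)%N = true); last by lia.
  rewrite (topv s (l.+1 - (k - m).+1)%N); last by lia.
  case: eqP => s0.
    rewrite (_ : odd k = false) /=; last by lia.
    rewrite (_ : (k - m < l)%N = false); last by lia.
    by rewrite c_w //; lia.
  rewrite andbF (_ : (k - m < l)%N = true); last by lia.
  by rewrite (_ : (l - (k - m).+1 = s.-1)%N) //; lia.
have lE' : l = (m - s.+1)%N :> nat := congr1 val lE; have sm := ltn_ord s.
rewrite rE eqxx X_mid; last by lia.
rewrite (_ : (l < m)%N = true); last by lia.
rewrite (_ : (l.+1 < m)%N = false); last by lia.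
rewrite (_ : (k - m < l.+1)%N = true); last by lia.
rewrite !(topv s); try lia.
by apply: eq_bigr => w' _; rewrite /ray_factor /ray_prev kodd s0 eqxx.
Qed.

Variable chi : 'I_n -> 'I_n -> ('I_k -> A) -> R[i].
Hypothesis chi_lin : forall i j, multilinear (chi i j).

Lemma chi_join_even i j c v' v : ~~ odd k ->
  chi i j (step_entry (join top c v' v)) =
  chi i j (merge (ray_factor c v') (ray_factor c v)).
Proof.
move=> k_even; congr (chi _ _ _); apply/funext => l.
rewrite (@step_entry_join c c) ?eqxx ?orbT // ifF //.
by apply/negbTE/eqP => /(congr1 val) /=; have := ltn_ord l; lia.
Qed.

(** Multilinearity in the middle entry pulls out the sum over virtual midpoints; the other entries
    do not depend on the midpoint. *)
Lemma chi_join_odd i j c v' v : odd k ->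
  chi i j (step_entry (join top c v' v)) =
  \sum_w chi i j (merge (ray_factor w v') (ray_factor w v)).
Proof.
move=> k_odd; have lk : (k./2 < k)%N by lia.
pose l0 := Ordinal lk; have r0 : rev_ord l0 = l0 by apply: val_inj => /=; lia.
have r0P (l : 'I_k) : (rev_ord l == l) = (l == l0).
  apply/eqP/eqP => [/(congr1 val) /= rl|-> //].
  by apply: val_inj => /=; have := ltn_ord l; lia.
have -> : step_entry (join top c v' v) =
    [eta merge (ray_factor c v') (ray_factor c v) with l0 |->
      \sum_w merge (ray_factor w v') (ray_factor w v) l0].
  apply/funext => l; rewrite (@step_entry_join c c) ?k_odd //= r0P.
  by case: eqP => // ->.
rewrite multilinear_sum //; apply: eq_bigr => w _; congr (chi _ _ _).
apply/funext => l /=; case: eqP => [-> //|/eqP ll0].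
have := @step_entry_join c c v' v l; have := @step_entry_join c w v' v l.
by rewrite k_odd r0P (negPf ll0) => <- // ->.
Qed.

Variables (K : hilbertType R) (pi : 'I_m -> A -> {linear K -> K}).
Variables (V : 'I_n -> {linear R[i]^o -> K}) (S : {linear K -> K}).
Hypothesis S_ge0 : forall x, 0 <= inner (S x) x.
Hypothesis chiE : forall i j b c, chi i j (merge c b) =
  inner (S (rep_prod pi b (V j 1))) (rep_prod pi c (V i 1)).

Lemma path_mx_ge0 (z : U -> R[i]) :
  0 <= \sum_u \sum_v (z u)^* * z v * path_mx chi X u v.
Proof.
pose G (r : {ffun 'I_k.+1 -> U}) : R[i] := (z (r ord0))^* * z (r ord_max) *
  chi (r ord0).2 (r ord_max).2 (step_entry r).
have -> : \sum_u \sum_v (z u)^* * z v * path_mx chi X u v = \sum_r G r.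
  rewrite pair_big /= [RHS](partition_big
    (fun r : {ffun 'I_k.+1 -> U} => (r ord0, r ord_max) : U * U) predT) //=.
  apply: eq_bigr => -[u v] _ /=; rewrite /path_mx mulr_sumr.
  by apply: eq_big => [r|r /andP[/eqP ru /eqP rv]]; rewrite ?xpair_eqE // /G ru rv.
(* [E c] collects all right halves issued from [c], weighted by [z] at their ends; the left halves
   give the second argument of the inner product. *)
pose E c := \sum_(v : ray) z (v top) *: rep_prod pi (ray_factor c v) (V (v top).2 1).
suff -> : \sum_r G r = \sum_c inner (S (E c)) (E c) by rewrite sumr_ge0.
have EE c : inner (S (E c)) (E c) = \sum_(v' : ray) \sum_(v : ray)
    (z (v' top))^* * z (v top) *
    chi (v' top).2 (v top).2 (merge (ray_factor c v') (ray_factor c v)).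
  rewrite inner_sumr; apply: eq_bigr => v' _.
  rewrite /E linear_sum inner_suml; apply: eq_bigr => v _.
  by rewrite [S (_ *: _)]linearZ innerZl innerZr chiE mulrA [_ * (z (v' top))^*]mulrC.
under [RHS]eq_bigr do rewrite EE.
have [k_odd|k_even] := boolP (odd k).
  rewrite (big_join_odd topE) // [RHS]exchange_big; apply: eq_bigr => v' _.
  rewrite [RHS]exchange_big; apply: eq_bigr => v _.
  by rewrite /G join_first // join_last // chi_join_odd // mulr_sumr.
rewrite (big_join_even topE) //; apply: eq_bigr => c _; apply: eq_bigr => v' _.
apply: eq_bigr => v _.
by rewrite /G join_first // join_last // chi_join_even.
Qed.

End GramPositive.

(** * Generators of the Stinespring space *)

Lemma gram_form_ge0 (R : realType) (U : finType) (Y : U -> U -> R[i]) (z : U -> R[i]) :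
  0 <= \sum_u \sum_v (z u)^* * z v * gram Y u v.
Proof.
have -> : \sum_u \sum_v (z u)^* * z v * gram Y u v =
    \sum_w (\sum_v z v * Y w v) * (\sum_v z v * Y w v)^*.
  under eq_bigr do under eq_bigr do rewrite mulr_sumr.
  under eq_bigr do rewrite exchange_big.
  rewrite exchange_big; apply: eq_bigr => w _.
  rewrite rmorph_sum mulr_sumr; apply: eq_bigr => u _.
  rewrite mulr_suml; apply: eq_bigr => v _.
  by rewrite rmorphM /= -[star _]/((Y w u)^*); ring.
by apply: sumr_ge0 => w _; exact: mul_conjC_ge0.
Qed.

Section BlockKernel.
Variables (R : realType) (A : cstarAlgType R) (n k : nat).
Notation m := (k.+1)./2.
Notation gen := (('I_m -> A) * ('I_n -> R[i]))%type.
Implicit Types (chi : 'I_n -> 'I_n -> ('I_k -> A) -> R[i]) (g h : gen).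

(** The pair (b, h) stands for the vector pi(b) (sum_i V_i h_i), the form in which generators occur
    in minimality. *)
Definition block_kernel chi g h : R[i] :=
  \sum_i \sum_j (h.2 i)^* * g.2 j * chi i j (merge h.1 g.1).

Lemma block_kernelB chi chi' g h :
  block_kernel (fun i j a => chi i j a - chi' i j a) g h =
  block_kernel chi g h - block_kernel chi' g h.
Proof.
rewrite /block_kernel -sumrB; apply: eq_bigr => i _.
by rewrite -sumrB; apply: eq_bigr => j _; rewrite mulrBr.
Qed.

Lemma block_kernel_delta chi b c i j :
  block_kernel chi (b, fun x => (x == j)%:R) (c, fun x => (x == i)%:R) =
  chi i j (merge c b).
Proof.
rewrite /block_kernel (bigD1 i) //= [X in _ + X]big1 ?addr0 => [|i' /negPf i'i].
  rewrite (bigD1 j) //= !eqxx rmorph1 !mul1r big1 ?addr0 // => j' /negPf ->.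
  by rewrite mulr0 mul0r.
by rewrite big1 // => j' _; rewrite i'i rmorph0 !mul0r.
Qed.

(** A list of length t calls for the t-th amplification, its entries indexing the copies. The empty
    list is set apart since a base index [u0] is needed. *)
Lemma block_kernel_ge0 chi (s : seq (R[i] * gen)) : (0 < n)%N -> (0 < k)%N ->
  icp_block chi -> 0 <= kernel_form (block_kernel chi) s s.
Proof.
move=> n0 k0 chi_icp; case: s => [|p s]; first by rewrite /kernel_form big_nil.
move: (p :: s) (isT : (0 < size (p :: s))%N) => {p}s s0.
pose el (x : 'I_(size s)) := tnth (in_tuple s) x.
have [Y YE] := merge_kernel_gram (fun u => (el u.1).2.1)
  (Ordinal s0, Ordinal n0) k0 chi_icp.
pose z (u : 'I_(size s) * 'I_n) := (el u.1).1 * (el u.1).2.2 u.2.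
have := gram_form_ge0 Y z; congr (0 <= _).
transitivity (\sum_x \sum_i \sum_y \sum_j (z (x, i))^* * z (y, j) * gram Y (x, i) (y, j)).
  rewrite [RHS]pair_bigA; apply: eq_bigr => -[x i] _.
  by rewrite [RHS]pair_bigA; apply: eq_bigr => -[y j] _.
rewrite /kernel_form [RHS]exchange_big [RHS]big_tnth; apply: eq_bigr => x _.
rewrite [RHS]big_tnth [LHS]exchange_big; apply: eq_bigr => y _; rewrite /block_kernel mulr_sumr.
apply: eq_bigr => i _; rewrite mulr_sumr; apply: eq_bigr => j _.
by rewrite -(YE (x, i) (y, j)) /z /= rmorphM -/(el x) -/(el y); ring.
Qed.

Variables (K : hilbertType R) (pi : 'I_m -> A -> {linear K -> K}).
Variables (V : 'I_n -> {linear R[i]^o -> K}).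

Definition generator g : K := rep_prod pi g.1 (\sum_i V i (g.2 i)).

Lemma generatorE g : generator g = \sum_i g.2 i *: rep_prod pi g.1 (V i 1).
Proof.
rewrite /generator.
have [f fE] : exists f : {linear K -> K}, forall x, f x = rep_prod pi g.1 x.
  by exists (HB.pack (rep_prod pi g.1)
    (GRing.isLinear.Build _ _ _ _ _ (rep_prod_is_linear pi g.1)) : {linear K -> K}).
rewrite -fE linear_sum; apply: eq_bigr => i _; rewrite -fE -linearZ; congr (f _).
by rewrite -[in LHS](mulr1 (g.2 i)) -[_ * 1]/(g.2 i *: (1 : R[i]^o)) linearZ.
Qed.

Lemma generator_delta b j : generator (b, fun x => (x == j)%:R) = rep_prod pi b (V j 1).
Proof.
rewrite generatorE (bigD1 j) //= eqxx scale1r big1 ?addr0 // => i /negPf ->.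
by rewrite scale0r.
Qed.

Lemma block_kernel_inner chi g h :
  (forall i j b c, chi i j (merge c b) =
     inner (rep_prod pi b (V j 1)) (rep_prod pi c (V i 1))) ->
  block_kernel chi g h = inner (generator g) (generator h).
Proof.
move=> chiE; rewrite !generatorE inner_sumr; apply: eq_bigr => i _.
rewrite inner_suml; apply: eq_bigr => j _.
by rewrite innerZl innerZr chiE; ring.
Qed.

Lemma minimal_triple_dense : minimal_triple pi V ->
  forall (x : K) (e : R), 0 < e -> exists s, nrm (x - lincomb generator s) < e.
Proof.
move=> V_min x e e0; have : closure (lin_span [set x | exists b (h : 'I_n -> R[i]^o),
    x = rep_prod pi b (\sum_(i < n) V i (h i))]) x by rewrite V_min.
move=> /(_ (ball x e%:C%C)) [|_ [[N [c [w [w_gen ->]]]]]].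
  by apply: nbhsx_ballx; rewrite ltcR.
rewrite -ball_normE /ball_ /= nrmE ltcR => xe.
have /choice[b] l := w_gen l.
move/choice => [h wE].
exists [seq (c l, (b l, h l)) | l <- index_enum _].
by rewrite /lincomb big_map; under eq_bigr do rewrite -[generator _]wE.
Qed.

End BlockKernel.

(** * The Radon-Nikodym operator *)

Section Domination.
Variables (R : realType) (A : cstarAlgType R) (n k : nat).
Hypotheses (n_gt0 : (0 < n)%N) (k_gt0 : (0 < k)%N).
Notation m := (k.+1)./2.
Variables (phi psi : 'I_n -> 'I_n -> ('I_k -> A) -> R[i]).
Hypotheses (phi_icp : icp_block phi) (psi_icp : icp_block psi).
Variables (K : hilbertType R) (pi : 'I_m -> A -> {linear K -> K}).
Variable V : 'I_n -> {linear R[i]^o -> K}.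
Hypothesis triple : stinespring_triple pi V phi.

Lemma phi_mergeE i j b c : phi i j (merge c b) =
  inner (rep_prod pi b (V j 1)) (rep_prod pi c (V i 1)).
Proof.
have [pi_rep pi_comm _ ->] := triple.
by rewrite (stinespring_form_merge pi_rep pi_comm).
Qed.

Lemma dominated_commutant : minimal_triple pi V -> icp_le psi phi ->
  exists T : {linear K -> K},
    [/\ continuous T, in_commutant pi T, op_le \0 T, op_le T idfun
      & forall i j a, psi i j a = stinespring_form pi V T i j a].
Proof.
have [pi_rep pi_comm _ _] := triple.
move=> /minimal_triple_dense dense le_psi_phi.
have psi_ge0 s := block_kernel_ge0 s n_gt0 k_gt0 psi_icp.
have psi_le s : kernel_form (block_kernel psi) s s <=
    inner (lincomb (generator pi V) s) (lincomb (generator pi V) s).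
  have := block_kernel_ge0 s n_gt0 k_gt0 le_psi_phi; rewrite -[_ <= inner _ _]subr_ge0.
  congr (0 <= _); rewrite inner_lincombl /kernel_form -sumrB.
  apply: eq_bigr => p _; rewrite inner_lincombr mulr_sumr -sumrB.
  apply: eq_bigr => q _.
  by rewrite block_kernelB mulrBr -(block_kernel_inner _ _ phi_mergeE) mulrA.
have [T [T_cont T_ge0 T_le T_sym TE]] := kernel_operator dense psi_ge0 psi_le.
(* Both tuples have the same folded arguments, as (a b_s)^* c_s = b_s^* (a^* c_s). *)
have psi_moveE s a i j b c :
    psi i j (merge (fun t => if t == s then a * b t else b t) c) =
    psi i j (merge b (fun t => if t == s then star a * c t else c t)).
  rewrite [LHS](icp_fold k_gt0 psi_icp) [RHS](icp_fold k_gt0 psi_icp).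
  congr (psi _ _ (merge _ _)).
  apply/funext => t; rewrite !folded_arg_merge.
  by case: eqP => // _; rewrite starM mulrA.
pose act s a (g : ('I_m -> A) * ('I_n -> R[i])) :=
  ((fun t => if t == s then a * g.1 t else g.1 t), g.2).
have pi_gen s a g : pi s a (generator pi V g) = generator pi V (act s a g).
  by rewrite /generator (rep_prod_mul pi_rep pi_comm).
have pi_adj s a x y : inner (pi s a x) y = inner x (pi s (star a) y).
  exact: star_rep_star.
have T_gen s a g : pi s a (T (generator pi V g)) = T (generator pi V (act s a g)).
  apply: (dense_inner_inj dense) => h.
  rewrite -T_sym TE -[a]starK -pi_adj pi_gen -T_sym TE starK.
  apply: eq_bigr => i _; apply: eq_bigr => j _.
  by rewrite psi_moveE.
(* Pairing with generators, the symmetry of [T] and the adjoints of [pi s] carry [T_gen] over to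
   every [x]. *)
have T_comm : in_commutant pi T.
  move=> s a x; apply: (dense_inner_inj dense) => g.
  rewrite -T_sym -[a]starK -!pi_adj pi_gen -T_sym -T_gen.
  by [].
exists T; split => // i j a.
rewrite (icp_fold k_gt0 psi_icp) -(stinespring_form_fold pi V T).
rewrite (stinespring_form_merge pi_rep pi_comm) // -!generator_delta TE.
by rewrite block_kernel_delta.
Qed.

Lemma commutant_dominated (T : {linear K -> K}) :
  in_commutant pi T -> op_le T idfun ->
  (forall i j a, psi i j a = stinespring_form pi V T i j a) ->
  icp_le psi phi.
Proof.
have [pi_rep pi_comm _ _] := triple.
move=> T_comm T_le psiE.
have diff_lin i j : multilinear (fun a => phi i j a - psi i j a).
  move=> l a c x y; rewrite (icp_multilinear phi_icp) (icp_multilinear psi_icp).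
  by rewrite mulrBr opprD addrACA.
have blockB X : block (fun i j a => phi i j a - psi i j a) X = block phi X - block psi X.
  by apply/matrixP => i j; rewrite !mxE -sumrB.
split=> //.
  move=> X Y; rewrite !blockB.
  by rewrite (icp_invariant phi_icp) (icp_invariant psi_icp).
apply: path_completely_positive => t X [X_star X_mid] z.
have [Y YE] : exists Y, forall l : 'I_k, k = l.*2.+1 -> X l = gram Y.
  (* An even [k] has no middle position, and 0 serves as [Y]. *)
  have [k_odd|k_even] := boolP (odd k); last by exists (fun _ _ => 0) => l kl; lia.
  have lk : (k./2 < k)%N by lia.
  have [|Y YE] := X_mid (Ordinal lk) _; first by rewrite /=; lia.
  exists Y => l kl; rewrite -YE; congr X; apply: val_inj => /=; lia.
have mk : (m.-1 < m)%N by lia.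
apply: (path_mx_ge0 k_gt0 X_star (top := Ordinal mk) _ YE diff_lin
  (pi := pi) (V := V) (S := idfun \- T)) => //.
move=> i j b c; rewrite phi_mergeE psiE (stinespring_form_merge pi_rep pi_comm) //.
by rewrite /= innerDl innerNl.
Qed.

End Domination.

Theorem theorem4p2 (R : realType) (A : cstarAlgType R) (n k : nat)
    (hn : (0 < n)%N) (hk : (0 < k)%N)
    (phi psi : 'I_n -> 'I_n -> ('I_k -> A) -> R[i])
    (hphi : icp_block phi) (hpsi : icp_block psi)
    (K : hilbertType R)
    (pi : 'I_(k.+1)./2 -> A -> {linear K -> K})
    (V : 'I_n -> {linear R[i]^o -> K})
    (htriple : stinespring_triple pi V phi)
    (hminimal : minimal_triple pi V) :
  icp_le psi phi <->
  exists T : {linear K -> K},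
    [/\ continuous T, in_commutant pi T, op_le \0 T, op_le T idfun
      & forall i j a, psi i j a = stinespring_form pi V T i j a].
Proof.
split; first exact: dominated_commutant.
by case=> T [_ T_comm _ T_le psiE]; apply: commutant_dominated T_comm T_le psiE.
Qed.
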